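(* Let $W_E:\mathcal{X}\to\mathcal{D}(\mathcal{K}_E)$ be a classical-quantum channel on a finite set $\mathcal{X}$, let $\mathcal{L}\subset\mathcal{X}$, and let $\{f_s\}_{s\in\mathcal{S}}$, $f_s:\mathcal{L}\to\mathcal{M}'$, be a (balanced) universal hash function family, with $\mathsf{L}_2:=|\mathcal{L}|/|\mathcal{M}'|$. Then the encoders $\Gamma[f_s]$ satisfy $$\bar d(M';ES)[\Gamma[f_S]]\le\min_{0\le t\le1}2^{\frac{1-t}{1+t}}\,2^{\frac{t}{1+t}\left(-\log\mathsf{L}_2+\tilde I^{\downarrow}_{1+t}(X;E|W_E\times P_{\mathcal{L}})\right)}.$$
   Context: Logarithms base 2; $\mathcal{D}(\mathcal{K})$ is the set of density operators on a finite-dimensional Hilbert space $\mathcal{K}$. A family $\{f_s\}_{s\in\mathcal{S}}$ of functions $f_s:\mathcal{L}\to\mathcal{M}'$ between finite sets, with $S$ uniform on the finite set $\mathcal{S}$, is a (balanced) universal hash function family if (C1) $\Pr_S[f_S(l)=f_S(l')]\le 1/|\mathcal{M}'|$ for all $l\ne l'\in\mathcal{L}$, and (C2) $|\{l\in\mathcal{L}:f_s(l)=m'\}|=|\mathcal{L}|/|\mathcal{M}'|$ for all $s\in\mathcal{S}$, $m'\in\mathcal{M}'$. The encoder $\Gamma[f_s]$ maps $m'\in\mathcal{M}'$ to the uniform distribution on $f_s^{-1}(m')$. With $M'$ uniform on $\mathcal{M}'$, define $\tau_{M'E|S=s}=\sum_{m'}\frac{1}{|\mathcal{M}'|}|m'\rangle\langle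 m'|\otimes\frac{1}{\mathsf{L}_2}\sum_{l\in f_s^{-1}(m')}W_E(l)$, $\tau_{E|S=s}=\mathrm{Tr}_{M'}\tau_{M'E|S=s}$, $P_{\mathcal{M}'}$ the uniform distribution (as a diagonal density operator), and $\bar d(M';ES)[\Gamma[f_S]]:=\frac{1}{|\mathcal{S}|}\sum_{s}\|\tau_{M'E|S=s}-P_{\mathcal{M}'}\otimes\tau_{E|S=s}\|_1$. $W_E\times P_{\mathcal{L}}:=\sum_{l\in\mathcal{L}}\frac{1}{|\mathcal{L}|}|l\rangle\langle l|\otimes W_E(l)$. The sandwiched Rényi divergence is $\tilde D_{1+t}(\rho\|\sigma)=\frac1t\log\mathrm{Tr}\big(\sigma^{-\frac{t}{2(1+t)}}\rho\sigma^{-\frac{t}{2(1+t)}}\big)^{1+t}$ (for $t=0$, the limit, i.e. the relative entropy), and for a cq state $\rho_{XE}$, $\tilde I^{\downarrow}_{1+t}(X;E|\rho_{XE}):=\inf_{\sigma_E\in\mathcal{D}(\mathcal{K}_E)}\tilde D_{1+t}(\rho_{XE}\|\rho_X\otimes\sigma_E)$. *)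

(* Defs.v *)
From HB Require Import structures.
From mathcomp Require Import all_boot all_order all_algebra.
From mathcomp Require Import complex.
From mathcomp Require Import all_classical all_reals all_analysis.

Set Implicit Arguments.
Unset Strict Implicit.
Unset Printing Implicit Defensive.

Import Order.TTheory GRing.Theory Num.Theory.
Local Open Scope ring_scope.
Local Open Scope classical_set_scope.

Section QDefs.
Variable R : realType.
Local Notation C := (R[i]).

Definition log2 (x : R) : R := ln x / ln 2.

Definition adj m n (A : 'M[C]_(m, n)) : 'M[C]_(n, m) := (map_mx conjc A)^T.

Definition psdmx d (A : 'M[C]_d) : Prop :=
  A \is hermsymmx /\ forall v : 'rV[C]_d, 0 <= (v *m A *m adj v) 0 0.

Definition density d (A : 'M[C]_d) : Prop := psdmx A /\ \tr A = 1.

(* functional calculus for a (normal, in practice Hermitian) matrix via the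
   library's spectral decomposition A = P^-1 diag(D) P (P unitary):
   g(A) := P^-1 diag(g(Re D)) P. *)
Definition mxfun d (g : R -> R) (A : 'M[C]_d) : 'M[C]_d :=
  invmx (spectralmx A) *m
  diag_mx (map_mx (fun z : C => real_complex R (g (complex.Re z))) (spectral_diag A)) *m
  spectralmx A.

Definition gpow (p : R) (x : R) : R := if x == 0 then 0 else powR x p.
Definition mpow d (A : 'M[C]_d) (p : R) : 'M[C]_d := mxfun (gpow p) A.

Definition glog2 (x : R) : R := if x == 0 then 0 else log2 x.
Definition mlog2 d (A : 'M[C]_d) : 'M[C]_d := mxfun glog2 A.

Definition trnorm d (A : 'M[C]_d) : R := complex.Re (\tr (mpow (adj A *m A) (2^-1))).

(* support inclusion supp rho <= supp sigma (row spaces; for Hermitian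
   matrices equivalent to inclusion of ranges) *)
Definition supp_le d (rho sigma : 'M[C]_d) : bool := (rho <= sigma)%MS.

Definition relent d (rho sigma : 'M[C]_d) : \bar R :=
  if supp_le rho sigma then (complex.Re (\tr (rho *m (mlog2 rho - mlog2 sigma))))%:E
  else +oo%E.

Definition sandwiched d (t : R) (rho sigma : 'M[C]_d) : \bar R :=
  if t == 0 then relent rho sigma
  else if supp_le rho sigma then
    let s := mpow sigma (- (t / (2 * (1 + t)))) in
    (t^-1 * log2 (complex.Re (\tr (mpow (s *m rho *m s) (1 + t)))))%:E
  else +oo%E.

(* For a cq state rho_XE = sum_x |x><x| (x) B x (given by its blocks B x, x < n),
   I^down_{1+t}(X;E) = inf_{sigma_E} D~_{1+t}(rho_XE || rho_X (x) sigma_E),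
   where rho_X (x) sigma_E = sum_x |x><x| (x) Tr(B x) sigma_E. *)
Definition cqstate n d (B : 'I_n -> 'M[C]_d) : 'M[C]_(\sum_(x < n) d) :=
  \mxdiag_(x < n) B x.

Definition Idown n d (t : R) (B : 'I_n -> 'M[C]_d) : \bar R :=
  ereal_inf [set sandwiched t (cqstate B) (cqstate (fun x => \tr (B x) *: sigma))
            | sigma in [set sigma : 'M[C]_d | density sigma]].

Definition WxPL nX d (W : 'I_nX -> 'M[C]_d) (L : {set 'I_nX}) : 'I_nX -> 'M[C]_d :=
  fun x => if x \in L then (#|L|%:R)^-1 *: W x else 0.

Definition universal_hash nX mM (S : finType) (L : {set 'I_nX})
    (f : S -> 'I_nX -> 'I_mM) : Prop :=
  (forall l l', l \in L -> l' \in L -> l != l' ->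
     (#|[set s | f s l == f s l']|%:R / #|S|%:R : R) <= (mM%:R)^-1) /\
  (forall s (m : 'I_mM), (#|[set l in L | f s l == m]|%:R : R) = #|L|%:R / mM%:R).

Definition tau_blocks nX mM d (S : finType) (W : 'I_nX -> 'M[C]_d) (L : {set 'I_nX})
    (f : S -> 'I_nX -> 'I_mM) (s : S) : 'I_mM -> 'M[C]_d :=
  fun m => ((mM%:R)^-1 * ((#|L|%:R / mM%:R)^-1)) *: \sum_(l in L | f s l == m) W l.

Definition tau_E nX mM d (S : finType) (W : 'I_nX -> 'M[C]_d) (L : {set 'I_nX})
    (f : S -> 'I_nX -> 'I_mM) (s : S) : 'M[C]_d :=
  \sum_(m < mM) tau_blocks W L f s m.

Definition dbar nX mM d (S : finType) (W : 'I_nX -> 'M[C]_d) (L : {set 'I_nX})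
    (f : S -> 'I_nX -> 'I_mM) : R :=
  (#|S|%:R)^-1 * \sum_(s : S)
     trnorm (cqstate (tau_blocks W L f s)
             - cqstate (fun m : 'I_mM => (mM%:R)^-1 *: tau_E W L f s)).

End QDefs.

(* Main.v *)
Require Import Defs.
From HB Require Import structures.
From mathcomp Require Import all_boot all_order all_algebra.
From mathcomp Require Import complex ring lra.
From mathcomp Require Import all_classical all_reals all_analysis.
Import Order.TTheory GRing.Theory Num.Theory.
Local Open Scope ring_scope.

(* Write p = 1 + t, a = t / (2 (1 + t)), and for a density sigma supporting the
   channel put X_l = sigma^-a W_l sigma^-a. The quantity to bound is then the
   average of (1/|L|) sum_m || sigma^a G_(s,m)(X) sigma^a ||_1, where
     G_(s,m)(X) = sum_(f_s l = m) X_l - (1/M) sum_l X_l,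
   and Hoelder's inequality reduces it to the average of sum_m ||G_(s,m)(X)||_p^p.
   The map G has norm at most 2 from l_1 to l_1. From l_2 to l_2 it contracts, but
   only on families of positive matrices: collision probabilities are merely
   bounded above, so tr A_l A_l' >= 0 is needed. This rules out complex
   interpolation. With the Huber function h_r(x) = x^2 for x <= r and
   2 r x - r^2 for x > r, splitting each X_l as (X_l - 2r)_+ + min(X_l, 2r) keeps
   both parts positive and yields
     E_s sum_m tr h_r(|G_(s,m)(X)|) <= sum_l tr h_2r(X_l)   for all r > 0.
   Since x^p is proportional to the integral of h_r(x) r^(p-3) dr, integrating
   over r gives E_s sum_m ||G_(s,m)(X)||_p^p <= 2^(2-p) sum_l ||X_l||_p^p, which is
   exactly the constant required. *)

Set Implicit Arguments.
Unset Strict Implicit.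
Unset Printing Implicit Defensive.

(** * Huber functions *)

Section Huber.
Import numFieldNormedType.Exports.
Local Open Scope classical_set_scope.
Variable R : realType.
Implicit Types r x p : R.

Definition huber r x : R := if x <= r then x ^+ 2 else 2 * r * x - r ^+ 2.

Lemma is_derive_cvg (f : R -> R) x d : is_derive x 1 f d ->
  (fun h : R => h^-1 *: (f (h *: 1 + x) - f x)) @ 0^' --> d.
Proof.
move=> [df <-]; rewrite /derive; exact: df.
Qed.

(** Since [f x = g x], every difference quotient of the glued function at [x] is a difference
    quotient of [f] or of [g], and so tends to their common limit. *)
Lemma is_derive_glue (f g : R -> R) x d :
  is_derive x 1 f d -> is_derive x 1 g d -> f x = g x ->
  is_derive x 1 (fun r => if r < x then f r else g r) d.
Proof.
move=> /is_derive_cvg cf /is_derive_cvg cg fg.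
set k := fun r => _.
have ck : (fun h : R => h^-1 *: (k (h *: 1 + x) - k x)) @ 0^' --> d.
  move=> A dA; apply: (@filterS2 _ (0 : R)^' _ _ _ _ _ (cf A dA) (cg A dA)) => h /=.
  by rewrite /k ltxx; case: ifP => _; rewrite ?fg.
split; first exact: cvgP ck.
exact: cvg_lim ck.
Qed.

(* a primitive in [r] of [huber r x * r `^ (p - 3)] *)
Definition huber_prim p x r : R :=
  if r < x then 2 * x / (p - 1) * r `^ (p - 1) - p^-1 * r `^ p
  else (2 / (p - 1) - p^-1 + (2 - p)^-1) * x `^ p
       - x ^+ 2 / (2 - p) * r `^ (p - 2).

Lemma is_derive_huber_prim p x r : 1 < p < 2 -> 0 <= x -> 0 < r ->
  is_derive r 1 (huber_prim p x) (huber r x * r `^ (p - 3)).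
Proof.
move=> /andP[p1 p2] x0 r0.
have e1 : p - 1 != 0 by rewrite subr_eq0 gt_eqF.
have e2 : 2 - p != 0 by rewrite subr_eq0 gt_eqF.
have e0 : p != 0 by rewrite gt_eqF// (lt_trans _ p1).
(* All powers are reduced to the one with exponent [p - 3], which turns the derivative identities
   into rational ones. *)
have pw1 (s : R) : 0 < s -> s `^ (p - 2) = s * s `^ (p - 3).
  move=> s0; rewrite -{2}(powRr1 (ltW s0)) -powRD ?(gt_eqF s0) ?implybT//.
  by congr (_ `^ _); ring.
have pw2 (s : R) : 0 < s -> s `^ (p - 1) = s ^+ 2 * s `^ (p - 3).
  move=> s0; rewrite -powR_mulrn ?ltW// -powRD ?(gt_eqF s0) ?implybT//.
  by congr (_ `^ _); ring.
have pw3 (s : R) : 0 < s -> s `^ p = s ^+ 3 * s `^ (p - 3).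
  move=> s0; rewrite -powR_mulrn ?ltW// -powRD ?(gt_eqF s0) ?implybT//.
  by congr (_ `^ _); ring.
pose f r := 2 * x / (p - 1) * r `^ (p - 1) - p^-1 * r `^ p.
pose g r := (2 / (p - 1) - p^-1 + (2 - p)^-1) * x `^ p
       - x ^+ 2 / (2 - p) * r `^ (p - 2).
have df (s : R) : 0 < s -> is_derive s 1 f ((2 * s * x - s ^+ 2) * s `^ (p - 3)).
  move=> s0; rewrite /f.
  have D1 := is_deriveZ (2 * x / (p - 1)) (is_derive1_powR (p - 1) s0).
  have D2 := is_deriveZ (p^-1) (is_derive1_powR p s0).
  have := is_deriveB D1 D2.
  move/is_derive_eq; apply.
  rewrite /GRing.scale /= pw2// (_ : p - 1 - 1 = p - 2); last by ring.
  by rewrite pw1//; field; rewrite e0 e1.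
have dg (s : R) : 0 < s -> is_derive s 1 g (x ^+ 2 * s `^ (p - 3)).
  move=> s0; rewrite /g.
  have D1 := is_deriveZ (x ^+ 2 / (2 - p)) (is_derive1_powR (p - 2) s0).
  have D0 := is_derive_cst ((2 / (p - 1) - p^-1 + (2 - p)^-1) * x `^ p) s 1.
  have := is_deriveB D0 D1.
  move/is_derive_eq; apply.
  rewrite /GRing.scale /= (_ : p - 2 - 1 = p - 3); last by ring.
  by field.
rewrite /huber; have [rx|rx|rx] := ltgtP r x.
- apply: near_eq_is_derive (df _ r0).
  near=> s; rewrite /huber_prim ifT//.
  by near: s; exact: lt_nbhsl.
- apply: near_eq_is_derive (dg _ r0).
  near=> s; rewrite /huber_prim ifF//.
  by apply/negbTE; rewrite -leNgt ltW//; near: s; exact: lt_nbhsr.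
(* The branches meet at [r = x]: the constant [2 / (p - 1) - p^-1 + (2 - p)^-1] in the second branch
   is chosen for that. *)
- subst x; apply: is_derive_glue (dg _ r0) _.
    by apply: is_derive_eq (df _ r0) _; congr (_ * _); ring.
  by rewrite /f /g /= pw1// pw2// pw3//; field; rewrite e0 e1 e2.
Unshelve. all: by end_near. Qed.

(** The weighted sum of primitives has a nonnegative derivative on [r > 0], so the mean value
    theorem stands in for integration over [[a, b]]. *)
Lemma huber_prim_le p n (y v : 'I_n -> R) (a b : R) :
  1 < p < 2 -> (forall i, 0 <= y i) ->
  (forall r, 0 < r -> 0 <= \sum_i v i * huber r (y i)) ->
  0 < a <= b ->
  \sum_i v i * huber_prim p (y i) a <= \sum_i v i * huber_prim p (y i) b.
Proof.
move=> p12 y0 H /andP[a0 ab].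
pose F := \sum_i (v i \*: huber_prim p (y i)).
have FE r : F r = \sum_i v i * huber_prim p (y i) r by rewrite /F fct_sumE.
have dF r : 0 < r ->
    is_derive r 1 F (\sum_i v i * (huber r (y i) * r `^ (p - 3))).
  move=> r0; apply: is_derive_sum => i; apply: is_deriveZ.
  exact: is_derive_huber_prim.
have dpos r : 0 < r -> 0 <= \sum_i v i * (huber r (y i) * r `^ (p - 3)).
  move=> r0; under eq_bigr do rewrite mulrA.
  by rewrite -mulr_suml mulr_ge0 ?H ?powR_ge0.
rewrite -!FE -subr_ge0.
have [r rab ->] : exists2 r, r \in `[a, b]%R & F b - F a =
    (\sum_i v i * (huber r (y i) * r `^ (p - 3))) * (b - a).
  apply: MVT_segment => //.
    by move=> r; rewrite in_itv/= => /andP[ar _]; apply: dF; exact: lt_trans ar.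
  apply: derivable_within_continuous => r; rewrite in_itv/= => /andP[ar _].
  by have [] := dF r (lt_le_trans a0 ar).
move: rab; rewrite in_itv/= => /andP[ar _].
by rewrite mulr_ge0 ?subr_ge0// dpos// (lt_le_trans a0 ar).
Qed.


(** Controls the boundary term at the lower end, which vanishes with [a] because [p - 1 > 0]. The
    alternative on [x] keeps a positive [x] on the first branch of the primitive. *)
Lemma huber_prim_near0 p x a : 1 < p < 2 -> 0 < a -> x = 0 \/ a < x ->
  `|huber_prim p x a| <= x * (2 / (p - 1) + p^-1) * a `^ (p - 1).
Proof.
move=> /andP[p1 p2] a0 [->|ax].
  rewrite /huber_prim ltNge (ltW a0)/= powR0; last by rewrite gt_eqF// (lt_trans _ p1).
  by rewrite expr0n/= !mulr0 !mul0r subrr normr0.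
have x0 : 0 < x by apply: lt_trans ax.
have p0 : 0 < p by apply: lt_trans p1.
have pw : a `^ p = a * a `^ (p - 1) by rewrite mulr_powRB1// ltW.
rewrite /huber_prim ax pw (le_trans (ler_normB _ _))//.
have A0 := powR_ge0 a (p - 1).
have x0' := ltW x0; have a0' := ltW a0; have p0' := ltW p0; have p1' := ltW p1.
rewrite [X in X + _]ger0_norm ?(mulr_ge0, invr_ge0, subr_ge0)//.
rewrite [X in _ + X]ger0_norm ?(mulr_ge0, invr_ge0)//.
have i0 : 0 <= p^-1 * a `^ (p - 1) by rewrite mulr_ge0// invr_ge0 ltW.
have le1 : p^-1 * (a * a `^ (p - 1)) <= x * p^-1 * a `^ (p - 1).
  by rewrite mulrCA -mulrA ler_wpM2r// ltW.
rewrite mulrDr mulrDl; apply: lerD => //.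
by rewrite (_ : 2 * x / (p - 1) = x * (2 / (p - 1)))//; ring.
Qed.

(** Let [a] tend to 0 and [b] to infinity in [huber_prim_le]: of the primitives only [V] survives.
    The limit is replaced by error bounds linear in a single parameter [d]. *)
Lemma huber_sum_powR_ord p n (y v : 'I_n -> R) : 1 < p < 2 ->
  (forall i, 0 <= y i) ->
  (forall r, 0 < r -> 0 <= \sum_i v i * huber r (y i)) ->
  0 <= \sum_i v i * y i `^ p.
Proof.
move=> p12 y0 H; have /andP[p1 p2] := p12.
have p1' : 0 < p - 1 by rewrite subr_gt0.
have p2' : 0 < 2 - p by rewrite subr_gt0.
pose C := 2 / (p - 1) - p^-1 + (2 - p)^-1.
have C0 : 0 < C.
  rewrite /C addr_gt0 ?invr_gt0// subr_gt0 (@lt_trans _ _ 1)//.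
    by rewrite invf_lt1// (lt_trans _ p1).
  by rewrite ltr_pdivlMr// mul1r; lra.
rewrite -(pmulr_rge0 _ C0); set V := C * _.
pose B := \sum_i v i * (y i ^+ 2 / (2 - p)).
pose K := \sum_i `|v i| * (y i * (2 / (p - 1) + p^-1)).
have K0 : 0 <= K.
  apply: sumr_ge0 => i _; rewrite !mulr_ge0// addr_ge0 ?invr_ge0 ?mulr_ge0 ?invr_ge0 ?ltW//.
  by rewrite (lt_trans _ p1).
pose b0 := 1 + \sum_i y i.
have yb0 i : y i <= b0.
  rewrite /b0 (bigD1 i)//= addrCA lerDl addr_ge0// sumr_ge0//.
have b01 : 1 <= b0 by rewrite lerDl sumr_ge0.
(* This lies below every nonzero [y i]; a vanishing [y i] adds nothing to the sum, since the inverse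
   of 0 is 0. *)
pose a0 := (1 + \sum_i (y i)^-1)^-1.
have iy0 i : 0 <= (y i)^-1 by rewrite invr_ge0.
have a0i : 1 <= 1 + \sum_i (y i)^-1 by rewrite lerDl sumr_ge0.
have a00 : 0 < a0 by rewrite invr_gt0 (lt_le_trans _ a0i).
have ya0 i : y i = 0 \/ a0 < y i.
  have [->|yi] := eqVneq (y i) 0; [by left|right].
  have yi0 : 0 < y i by rewrite lt_def yi y0.
  rewrite /a0 -[ltRHS]invrK ltf_pV2 ?posrE ?invr_gt0//; last first.
    exact: lt_le_trans a0i.
  by rewrite (bigD1 i)//= addrCA ltrDl ltr_pwDl// sumr_ge0.
pose d0 := Num.min (b0^-1 `^ (2 - p)) (a0 `^ (p - 1)).
have d00 : 0 < d0.
  by rewrite lt_min !powR_gt0// invr_gt0 (lt_le_trans _ b01).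
have key d : 0 < d <= d0 -> - (d * (`|B| + K)) <= V.
  move=> /andP[dp]; rewrite le_min => /andP[db da].
  (* The cutoffs make the power [p - 1] of [a] and the power [p - 2] of [b] both equal to [d]; then
     [d <= d0] yields [a <= a0] and [b0 <= b]. *)
  pose a := d `^ ((p - 1)^-1).
  pose b := (d `^ ((2 - p)^-1))^-1.
  have ap : 0 < a by rewrite powR_gt0.
  have bp : 0 < b by rewrite invr_gt0 powR_gt0.
  have aE : a `^ (p - 1) = d.
    by rewrite -powRrM mulVf ?gt_eqF// powRr1// ltW.
  have bE : b `^ (p - 2) = d.
    rewrite /b -powRN -powRrM (_ : _ * _ = 1) ?powRr1 ?(ltW dp)//.
    by field; rewrite gt_eqF.
  have aa0 : a <= a0.
    have ip : 0 <= (p - 1)^-1 by rewrite invr_ge0 ltW.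
    rewrite (le_trans (ge0_ler_powR ip _ _ da)) ?nnegrE ?powR_ge0 ?(ltW dp)//.
    by rewrite -powRrM mulfV ?gt_eqF// powRr1 ?(ltW a00).
  have bb0 : b0 <= b.
    have b0p : 0 < b0 by apply: lt_le_trans b01.
    rewrite -[leLHS]invrK lef_pV2 ?posrE ?invr_gt0 ?powR_gt0//.
    have ip : 0 <= (2 - p)^-1 by rewrite invr_ge0 ltW.
    rewrite (le_trans (ge0_ler_powR ip _ _ db)) ?nnegrE ?powR_ge0 ?(ltW dp)//.
    by rewrite -powRrM mulfV ?gt_eqF// powRr1 ?invr_ge0 ?(ltW b0p).
  have ab : 0 < a <= b.
    rewrite ap (le_trans aa0)// (le_trans _ bb0)// (le_trans _ b01)//.
    by rewrite invf_le1// (lt_le_trans _ a0i).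
  have := huber_prim_le p12 y0 H ab.
  have -> : \sum_i v i * huber_prim p (y i) b = V - B * d.
    rewrite /V /B mulr_sumr mulr_suml -sumrB; apply: eq_bigr => i _.
    rewrite /huber_prim ltNge (le_trans (yb0 i) bb0)/= bE -/C.
    by ring.
  move=> le1.
  have le2 : - (K * d) <= \sum_i v i * huber_prim p (y i) a.
    rewrite lerNl -sumrN /K mulr_suml; apply: ler_sum => i _.
    rewrite -mulrN (le_trans (ler_norm _))// normrM normrN -mulrA ler_wpM2l//.
    rewrite -aE huber_prim_near0//.
    by case: (ya0 i) => [|yi]; [left|right; apply: le_lt_trans yi].
  have le3 : - (`|B| * d) <= B * d.
    rewrite -mulNr ler_wpM2r// ?(ltW dp)//.
    by rewrite lerNl (le_trans (ler_norm _))// normrN.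
  by lra.
rewrite leNgt; apply/negP => V0.
(* For [V < 0], any [d <= e] makes the error in [key] smaller than [- V], a contradiction. *)
pose e := - V / (2 * (`|B| + K + 1)).
have D0 : 0 < `|B| + K + 1 by rewrite ltr_wpDl// addr_ge0.
have e0 : 0 < e by rewrite divr_gt0 ?mulr_gt0// oppr_gt0.
have := key (Num.min d0 e); rewrite lt_min d00 e0 ge_min lexx/= => /(_ isT).
apply/negP; rewrite -ltNge ltrNr.
apply: (@le_lt_trans _ _ (e * (`|B| + K))).
  by rewrite ler_wpM2r ?addr_ge0// ge_min lexx orbT.
rewrite /e -[ltRHS]mulr1 -mulrA ltr_pM2l ?oppr_gt0// mulrC ltr_pdivrMr ?mulr_gt0//.
by have := normr_ge0 B; lra.
Qed.

(* [x `^ p] is a positive mixture of the functions [huber r]. *)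
Lemma huber_sum_powR p (T : finType) (y v : T -> R) : 1 < p <= 2 ->
  (forall i, 0 <= y i) ->
  (forall r, 0 < r -> 0 <= \sum_i v i * huber r (y i)) ->
  0 <= \sum_i v i * y i `^ p.
Proof.
move=> /andP[p1]; rewrite le_eqVlt => /predU1P[->|p2] y0 H.
  (* At [p = 2] the primitive would divide by zero; instead a single [r] above all [y i] turns every
     Huber value into a square. *)
  pose r := 1 + \sum_i y i.
  have yr i : y i <= r.
    by rewrite /r (bigD1 i)//= addrCA lerDl addr_ge0// sumr_ge0.
  have r0 : 0 < r by rewrite ltr_pwDl// sumr_ge0.
  have := H r r0; under eq_bigr do rewrite /huber yr.
  by move=> h; under eq_bigr do rewrite (powR_mulrn 2)//.
rewrite big_enum_val; apply: huber_sum_powR_ord => //; first by rewrite p1.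
by move=> r r0; have := H r r0; rewrite big_enum_val.
Qed.

End Huber.

(** Young's inequality for [x i / a] and [y i / b], with [a] and [b] the two factors on the right,
    summed against the weights. If one of the sums is zero, every term on the left is zero. *)
Lemma hoelder_sum (R : realType) (T : finType) (w x y : T -> R) (p q : R) :
  0 < p -> 0 < q -> p^-1 + q^-1 = 1 ->
  (forall i, 0 <= w i) -> (forall i, 0 <= x i) -> (forall i, 0 <= y i) ->
  \sum_i w i * (x i * y i) <=
  (\sum_i w i * x i `^ p) `^ p^-1 * (\sum_i w i * y i `^ q) `^ q^-1.
Proof.
move=> p0 q0 pq w0 x0 y0; set A := \sum_i w i * x i `^ p; set B := \sum_i _ * y _ `^ q.
have wx i : 0 <= w i * x i `^ p by rewrite mulr_ge0 ?powR_ge0.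
have wy i : 0 <= w i * y i `^ q by rewrite mulr_ge0 ?powR_ge0.
have [A0|A0] := eqVneq A 0.
  rewrite big1 ?mulr_ge0 ?powR_ge0// => i _.
  have := @psumr_eq0P _ _ predT _ (fun j _ => wx j) A0 i isT; move/eqP.
  rewrite mulf_eq0 powR_eq0 => /orP[/eqP->|/andP[/eqP-> _]]; first by rewrite mul0r.
  by rewrite mul0r mulr0.
have [B0|B0] := eqVneq B 0.
  rewrite big1 ?mulr_ge0 ?powR_ge0// => i _.
  have := @psumr_eq0P _ _ predT _ (fun j _ => wy j) B0 i isT; move/eqP.
  rewrite mulf_eq0 powR_eq0 => /orP[/eqP->|/andP[/eqP-> _]]; first by rewrite mul0r.
  by rewrite !mulr0.
have Ap : 0 < A by rewrite lt_def A0 sumr_ge0.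
have Bp : 0 < B by rewrite lt_def B0 sumr_ge0.
set a := A `^ p^-1; set b := B `^ q^-1.
have ap : 0 < a by rewrite powR_gt0.
have bp : 0 < b by rewrite powR_gt0.
have aE : a `^ p = A by rewrite -powRrM mulVf ?gt_eqF// powRr1// ltW.
have bE : b `^ q = B by rewrite -powRrM mulVf ?gt_eqF// powRr1// ltW.
have iaE : a^-1 `^ p = A^-1.
  by rewrite -(powR_inv1 (ltW ap)) powRAC aE powR_inv1// ltW.
have ibE : b^-1 `^ q = B^-1.
  by rewrite -(powR_inv1 (ltW bp)) powRAC bE powR_inv1// ltW.
clearbody a b; have ab : 0 < a * b by rewrite mulr_gt0.
rewrite -[leRHS]mul1r -(ler_pdivrMr _ _ ab) mulr_suml.
have -> : 1 = \sum_i (w i * x i `^ p * (p^-1 / A) + w i * y i `^ q * (q^-1 / B)).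
  by rewrite big_split/= -!mulr_suml -/A -/B -pq; congr (_ + _);
    rewrite mulrCA mulfV ?mulr1.
apply: ler_sum => i _.
have := @conjugate_powR R (x i / a) (y i / b) p q.
rewrite !divr_ge0 ?(ltW ap) ?(ltW bp)// => /(_ isT isT p0 q0 pq).
rewrite !powRM ?invr_ge0 ?(ltW ap) ?(ltW bp)// iaE ibE.
move=> /(ler_wpM2l (w0 i)); rewrite mulrDr => h.
rewrite (_ : w i * (x i * y i) / _ = w i * (x i / a * (y i / b))); last first.
  by field; rewrite !gt_eqF.
apply: le_trans h _; rewrite le_eqVlt; apply/predU1P; left.
by congr (_ + _); field; rewrite !gt_eqF.
Qed.

(** * Spectral calculus of Hermitian matrices *)

Section Spectral.
Variable R : realType.
Local Notation C := R[i].
Local Notation rc := (real_complex R).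
Local Notation Re := (@complex.Re R).

Lemma hermsymmxE d (A : 'M[C]_d) : (A \is hermsymmx) = (A == adj A).
Proof.
by apply/is_hermitianmxP/eqP; rewrite expr0 scale1r /adj map_trmx.
Qed.

Lemma adjmxM m n p (A : 'M[C]_(m, n)) (B : 'M[C]_(n, p)) :
  adj (A *m B) = adj B *m adj A.
Proof. by rewrite /adj map_mxM trmx_mul. Qed.

Lemma adjmxK m n (A : 'M[C]_(m, n)) : adj (adj A) = A.
Proof. by apply/matrixP => i j; rewrite !mxE conjcK. Qed.

Lemma adjmxD m n (A B : 'M[C]_(m, n)) : adj (A + B) = adj A + adj B.
Proof. by apply/matrixP => i j; rewrite !mxE rmorphD. Qed.

Lemma adjmxB m n (A B : 'M[C]_(m, n)) : adj (A - B) = adj A - adj B.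
Proof. by apply/matrixP => i j; rewrite !mxE rmorphB. Qed.

Lemma adjmx0 m n : adj (0 : 'M[C]_(m, n)) = 0.
Proof. by apply/matrixP => i j; rewrite !mxE rmorph0. Qed.

Lemma adjmx1 n : adj (1%:M : 'M[C]_n) = 1%:M.
Proof. by rewrite /adj map_mx1 trmx1. Qed.

Lemma adjmxZ m n (c : R) (A : 'M[C]_(m, n)) : adj (rc c *: A) = rc c *: adj A.
Proof. by apply/matrixP => i j; rewrite !mxE rmorphM/= oppr0. Qed.

Lemma adj_sum (I : Type) (r : seq I) (P : pred I) m n (F : I -> 'M[C]_(m, n)) :
  adj (\sum_(i <- r | P i) F i) = \sum_(i <- r | P i) adj (F i).
Proof. by apply: (big_morph _ (@adjmxD m n) (@adjmx0 m n)). Qed.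

Definition rtr d (A : 'M[C]_d) : R := Re (\tr A).

Lemma ReD (x y : C) : Re (x + y) = Re x + Re y.
Proof. by case: x y => ? ? []. Qed.

Lemma Re_sum (I : Type) (r : seq I) (P : pred I) (F : I -> C) :
  Re (\sum_(i <- r | P i) F i) = \sum_(i <- r | P i) Re (F i).
Proof. exact: (big_morph Re ReD). Qed.

Lemma rtrD d (A B : 'M[C]_d) : rtr (A + B) = rtr A + rtr B.
Proof. by rewrite /rtr mxtraceD ReD. Qed.

Lemma rtr_sum d (I : Type) (r : seq I) (P : pred I) (F : I -> 'M[C]_d) :
  rtr (\sum_(i <- r | P i) F i) = \sum_(i <- r | P i) rtr (F i).
Proof. by rewrite /rtr (raddf_sum (@mxtrace _ d))/= Re_sum. Qed.

Lemma rtrZ d c (A : 'M[C]_d) : rtr (rc c *: A) = c * rtr A.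
Proof. by rewrite /rtr mxtraceZ; case: (\tr A) => a b /=; rewrite mul0r subr0. Qed.

Lemma rtrN d (A : 'M[C]_d) : rtr (- A) = - rtr A.
Proof. by rewrite -scaleN1r -(rmorphN1 rc) rtrZ mulN1r. Qed.

Lemma rtrB d (A B : 'M[C]_d) : rtr (A - B) = rtr A - rtr B.
Proof. by rewrite rtrD rtrN. Qed.

Lemma rtrC m n (A : 'M[C]_(m, n)) (B : 'M[C]_(n, m)) : rtr (A *m B) = rtr (B *m A).
Proof. by rewrite /rtr mxtrace_mulC. Qed.

(* the Hermitian matrix with eigenvalues [x i] on the rows of [U] *)
Definition hdec d (U : 'M[C]_d) (x : 'I_d -> R) : 'M[C]_d :=
  adj U *m diag_mx (\row_i rc (x i)) *m U.

Definition unitary d (U : 'M[C]_d) := U *m adj U = 1%:M.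

Lemma unitaryV d (U : 'M[C]_d) : unitary U -> adj U *m U = 1%:M.
Proof. exact: mulmx1C. Qed.

Lemma eq_hdec d (U : 'M[C]_d) x y : x =1 y -> hdec U x = hdec U y.
Proof. by move=> /funext ->. Qed.

Lemma adj_diag d (x : 'I_d -> R) :
  adj (diag_mx (\row_i rc (x i))) = diag_mx (\row_i rc (x i)).
Proof.
apply/matrixP => i j; rewrite !mxE eq_sym.
by case: eqP => [->|_]; rewrite /= ?rmorph0// oppr0.
Qed.

Lemma adj_hdec d (U : 'M[C]_d) x : adj (hdec U x) = hdec U x.
Proof. by rewrite /hdec !adjmxM adjmxK adj_diag mulmxA. Qed.

Lemma hdecM d (U : 'M[C]_d) x y : unitary U ->
  hdec U x *m hdec U y = hdec U (fun i => x i * y i).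
Proof.
move=> uU; rewrite /hdec !mulmxA -(mulmxA _ U (adj U)) uU mulmx1.
rewrite -(mulmxA _ (diag_mx _) (diag_mx _)) mulmx_diag.
by congr (_ *m diag_mx _ *m _); apply/rowP => i; rewrite !mxE -rmorphM.
Qed.

Lemma hdecD d (U : 'M[C]_d) x y :
  hdec U x + hdec U y = hdec U (fun i => x i + y i).
Proof.
rewrite /hdec -mulmxDl -mulmxDr -raddfD/=.
by congr (_ *m diag_mx _ *m _); apply/rowP => i; rewrite !mxE -rmorphD.
Qed.

Lemma hdecZ d (U : 'M[C]_d) c x : rc c *: hdec U x = hdec U (fun i => c * x i).
Proof.
rewrite /hdec scalemxAl scalemxAr -linearZ/=.
by congr (_ *m diag_mx _ *m _); apply/rowP => i; rewrite !mxE -rmorphM.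
Qed.

Lemma hdecN d (U : 'M[C]_d) x : hdec U (fun i => - x i) = - hdec U x.
Proof.
rewrite -scaleN1r -(rmorphN1 rc) hdecZ.
by apply: eq_hdec => i; rewrite mulN1r.
Qed.

Lemma hdecB d (U : 'M[C]_d) x y :
  hdec U x - hdec U y = hdec U (fun i => x i - y i).
Proof. by rewrite -hdecN hdecD. Qed.

Lemma hdec1 d (U : 'M[C]_d) : unitary U -> hdec U (fun=> 1) = 1%:M.
Proof.
move=> uU; rewrite /hdec (_ : diag_mx _ = 1%:M) ?mulmx1 ?unitaryV//.
by apply/matrixP => i j; rewrite !mxE.
Qed.

Lemma herm_hdec d (A : 'M[C]_d) : A = adj A ->
  exists U x, unitary U /\ A = hdec U x.
Proof.
move=> hA; have hA' : A \is hermsymmx by rewrite hermsymmxE -hA.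
have /orthomx_spectralP eA := hermitian_normalmx hA'.
have uU : unitary (spectralmx A).
  by have /unitarymxP := spectral_unitarymx A; rewrite /unitary /adj map_trmx.
exists (spectralmx A), (fun i => Re (spectral_diag A 0 i)); split; first exact: uU.
rewrite {1}eA /hdec (invmx_unitary (spectral_unitarymx A)) /adj map_trmx.
congr (_ *m diag_mx _ *m _); apply/rowP => i; rewrite !mxE RRe_real//.
by have /mxOverP := hermitian_spectral_diag_real hA'; exact.
Qed.

(** The calculus does not depend on the diagonalisation. The change of basis [P *m adj U] has
    nonzero entries only between equal eigenvalues, hence it also intertwines their images under
    [g]. *)
Lemma mxfun_hdec d (U : 'M[C]_d) g x : unitary U ->
  mxfun g (hdec U x) = hdec U (g \o x).
Proof.
move=> uU; set A := hdec U x.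
have hA : A \is hermsymmx by rewrite hermsymmxE adj_hdec.
have /orthomx_spectralP eA := hermitian_normalmx hA.
set P := spectralmx A in eA *; set D := spectral_diag A in eA *.
have uP : P \in unitmx by exact: spectral_unit.
have VE : diag_mx D *m (P *m adj U) = (P *m adj U) *m diag_mx (\row_i rc (x i)).
  have : P *m A = diag_mx D *m P by rewrite {1}eA !mulmxA mulmxV// mul1mx.
  move=> e; rewrite mulmxA -e /A /hdec !mulmxA.
  by rewrite -(mulmxA _ U (adj U)) uU mulmx1.
have VgE : diag_mx (map_mx (fun z : C => rc (g (Re z))) D) *m (P *m adj U) =
    (P *m adj U) *m diag_mx (\row_i rc (g (x i))).
  move: (P *m adj U) VE => V /matrixP VE; apply/matrixP => i j.
  move: (VE i j); rewrite !mul_diag_mx !mul_mx_diag !mxE.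
  have [->|z0] := eqVneq (V i j) 0; first by rewrite !mulr0 !mul0r.
  by rewrite mulrC => /(mulfI z0) ->; rewrite mulrC.
rewrite /mxfun -/P -/D /hdec; clearbody P D.
move: (diag_mx (map_mx _ D)) (diag_mx (\row_i rc ((g \o x) i))) VgE => G H GH.
rewrite -(mulKmx uP (adj U)) -(mulmxA _ (P *m adj U) H) -GH !mulmxA.
by rewrite -[RHS]mulmxA unitaryV// mulmx1.
Qed.

(** Squared moduli of the inner products between two eigenbases. For unitary [U] and [V] they form a
    doubly stochastic matrix, which reduces traces of products to scalar double sums. *)
Definition overlap d (U V : 'M[C]_d) i j : R :=
  let z := (U *m adj V) i j in Re (conjc z * z).

Lemma overlap_ge0 d (U V : 'M[C]_d) i j : 0 <= overlap U V i j.
Proof.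
rewrite /overlap; case: ((U *m adj V) i j) => a b /=.
by rewrite mulNr opprK addr_ge0// -expr2 sqr_ge0.
Qed.

Lemma overlap_sumr d (U V : 'M[C]_d) i : unitary U -> unitary V ->
  \sum_j overlap U V i j = 1.
Proof.
move=> uU uV; rewrite -Re_sum; set Z := U *m adj V.
have : Z *m adj Z = 1%:M.
  by rewrite adjmxM adjmxK mulmxA -(mulmxA U) unitaryV// mulmx1.
move=> /matrixP/(_ i i); rewrite !mxE eqxx => e.
rewrite (_ : \sum_j _ = true%:R)// -e; apply: eq_bigr => j _.
by rewrite mulrC !mxE.
Qed.

Lemma overlap_suml d (U V : 'M[C]_d) j : unitary U -> unitary V ->
  \sum_i overlap U V i j = 1.
Proof.
move=> uU uV; rewrite -Re_sum; set Z := U *m adj V.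
have : adj Z *m Z = 1%:M.
  by rewrite adjmxM adjmxK mulmxA -(mulmxA V) unitaryV// mulmx1.
move=> /matrixP/(_ j j); rewrite !mxE eqxx => e.
rewrite (_ : \sum_i _ = true%:R)// -e; apply: eq_bigr => i _.
by rewrite !mxE.
Qed.

Lemma rtr_hdecM d (U V : 'M[C]_d) x y :
  rtr (hdec U x *m hdec V y) = \sum_i \sum_j x i * y j * overlap U V i j.
Proof.
rewrite {1}/hdec [X in rtr (_ *m X)]/hdec !mulmxA rtrC !mulmxA.
rewrite -(mulmxA _ U (adj V)); set Z := U *m adj V.
have -> : V *m adj U = adj Z by rewrite adjmxM adjmxK.
rewrite exchange_big /rtr /mxtrace Re_sum; apply: eq_bigr => j _ /=.
rewrite mul_mx_diag !mxE mulr_suml Re_sum; apply: eq_bigr => i _.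
rewrite mul_mx_diag !mxE /overlap -/Z; set z := (U *m adj V) i j.
rewrite (_ : \sum_j0 _ = z); last by rewrite /z mxE.
by case: z => a b /=; ring.
Qed.

Lemma rtr_hdec d (U : 'M[C]_d) x : unitary U -> rtr (hdec U x) = \sum_i x i.
Proof.
move=> uU; rewrite /hdec rtrC mulmxA uU mul1mx /rtr mxtrace_diag Re_sum.
by apply: eq_bigr => i _; rewrite mxE.
Qed.

Lemma psd_adj d (A : 'M[C]_d) : psdmx A -> A = adj A.
Proof. by case; rewrite hermsymmxE => /eqP. Qed.

Lemma psd_hdecP d (A : 'M[C]_d) : psdmx A ->
  exists U x, [/\ unitary U, A = hdec U x & forall i, 0 <= x i].
Proof.
move=> pA; have [U [x [uU eA]]] := herm_hdec (psd_adj pA).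
exists U, x; split=> // i; have [_ /(_ (row i U))] := pA.
have -> : (row i U *m A *m adj (row i U)) 0 0 = (U *m A *m adj U) i i.
  by rewrite -row_mul !mxE; apply: eq_bigr => j _; rewrite !mxE.
rewrite eA /hdec !mulmxA uU mul1mx -mulmxA uU mulmx1 !mxE eqxx mulr1n.
by rewrite lecE /= => /andP[].
Qed.

Lemma psd_hdec d (U : 'M[C]_d) x : (forall i, 0 <= x i) -> psdmx (hdec U x).
Proof.
move=> x0; split=> [|v]; first by rewrite hermsymmxE adj_hdec.
rewrite /hdec !mulmxA -mulmxA -[X in _ *m (X *m _)]adjmxK -adjmxM.
set w := v *m adj U; rewrite mxE sumr_ge0// => j _.
rewrite mul_mx_diag !mxE; set z := w 0 j.
rewrite mulrAC mulr_ge0//; last by rewrite lecE /= eqxx x0.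
exact: mul_conjC_ge0.
Qed.

Lemma psd0 d : psdmx (0 : 'M[C]_d).
Proof.
split=> [|v]; first by rewrite hermsymmxE adjmx0.
by rewrite mulmx0 mul0mx mxE.
Qed.

Lemma psdD d (A B : 'M[C]_d) : psdmx A -> psdmx B -> psdmx (A + B).
Proof.
move=> pA pB; split=> [|v].
  by rewrite hermsymmxE adjmxD -(psd_adj pA) -(psd_adj pB).
by rewrite mulmxDr mulmxDl mxE addr_ge0//; [case: pA|case: pB].
Qed.

Lemma psd_sum d (I : Type) (r : seq I) (P : pred I) (F : I -> 'M[C]_d) :
  (forall i, P i -> psdmx (F i)) -> psdmx (\sum_(i <- r | P i) F i).
Proof. by move=> h; apply: big_ind; [exact: psd0|exact: psdD|exact: h]. Qed.

Lemma psdZ d c (A : 'M[C]_d) : 0 <= c -> psdmx A -> psdmx (rc c *: A).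
Proof.
move=> c0 /psd_hdecP[U [x [uU -> x0]]]; rewrite hdecZ.
by apply: psd_hdec => i; rewrite mulr_ge0.
Qed.

Lemma psd_conj d (S A : 'M[C]_d) : S = adj S -> psdmx A -> psdmx (S *m A *m S).
Proof.
move=> hS pA; split=> [|v].
  by rewrite hermsymmxE !adjmxM -hS -(psd_adj pA) mulmxA.
have [_ /(_ (v *m S))] := pA.
by rewrite adjmxM -hS !mulmxA.
Qed.

Lemma rtr_psdM_ge0 d (A B : 'M[C]_d) : psdmx A -> psdmx B -> 0 <= rtr (A *m B).
Proof.
move=> /psd_hdecP[U [x [uU -> x0]]] /psd_hdecP[V [y [uV -> y0]]].
rewrite rtr_hdecM; do 2!apply: sumr_ge0 => ? _.
by rewrite !mulr_ge0 ?overlap_ge0.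
Qed.

(** Expand in overlaps: the weights [x i] are nonnegative and each row of overlaps sums to one. *)
Lemma rtr_psd_hdec_le d (A V : 'M[C]_d) r y : psdmx A -> unitary V ->
  (forall j, y j <= r) -> rtr (A *m hdec V y) <= r * rtr A.
Proof.
move=> /psd_hdecP[U [x [uU -> x0]]] uV yr.
rewrite rtr_hdecM rtr_hdec// mulr_sumr; apply: ler_sum => i _.
rewrite -[leRHS]mulr1 -(overlap_sumr i uU uV) mulr_sumr; apply: ler_sum => j _.
by rewrite ler_wpM2r ?overlap_ge0// mulrC ler_wpM2r.
Qed.

Lemma rtr_herm_sqr_ge0 d (A : 'M[C]_d) : A = adj A -> 0 <= rtr (A *m A).
Proof.
move=> /herm_hdec[U [x [uU ->]]]; rewrite hdecM// rtr_hdec//.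
by apply: sumr_ge0 => i _; rewrite -expr2 sqr_ge0.
Qed.

Lemma rtr_herm_young d (A B : 'M[C]_d) : A = adj A -> B = adj B ->
  2 * rtr (A *m B) <= rtr (A *m A) + rtr (B *m B).
Proof.
move=> hA hB; have := @rtr_herm_sqr_ge0 _ (A - B).
rewrite adjmxB -hA -hB => /(_ erefl).
rewrite mulmxBl !mulmxBr !rtrB (rtrC B A); lra.
Qed.

End Spectral.

(** * Block diagonal matrices and trace norms *)

Section Blocks.
Variable R : realType.
Local Notation C := R[i].
Local Notation rc := (real_complex R).
Variables n d : nat.
Implicit Types A B : 'I_n -> 'M[C]_d.

Lemma cqstateM A B : cqstate A *m cqstate B = cqstate (fun i => A i *m B i).
Proof.
rewrite /cqstate {2}/mxdiag mul_mxdiag_mxblock; apply/eq_mxblock => i j.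
by case: eqVneq => [->|_]; rewrite ?mulmx0// !conform_mx_id.
Qed.

Lemma cqstateB A B : cqstate A - cqstate B = cqstate (fun i => A i - B i).
Proof. by rewrite /cqstate mxdiagB. Qed.

Lemma adj_cqstate A : adj (cqstate A) = cqstate (fun i => adj (A i)).
Proof.
apply/matrixP => i j; rewrite !mxE eq_sym.
case: eqVneq => [e|_]; last by rewrite !mxE rmorph0.
by rewrite e !conform_mx_id !mxE.
Qed.

(** Eigenbases of the blocks assemble into one of the whole matrix; [tagnat.sig1] and [tagnat.sig2]
    decode a flat index into a block and a position inside it. *)
Lemma hdec_cqstate (U : 'I_n -> 'M[C]_d) (x : 'I_n -> 'I_d -> R) :
  cqstate (fun i => hdec (U i) (x i)) =
  hdec (cqstate U) (fun k => x (tagnat.sig1 k) (tagnat.sig2 k)).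
Proof.
rewrite /hdec adj_cqstate.
have -> : diag_mx (\row_k rc (x (tagnat.sig1 k) (tagnat.sig2 k))) =
    cqstate (fun i => diag_mx (\row_j rc (x i j))).
  rewrite /cqstate -diag_mxrow; congr diag_mx.
  by apply/rowP => k; rewrite !mxE.
by rewrite !cqstateM.
Qed.

Lemma unitary_cqstate (U : 'I_n -> 'M[C]_d) :
  (forall i, unitary (U i)) -> unitary (cqstate U).
Proof.
move=> uU; rewrite /unitary adj_cqstate cqstateM /cqstate -mxdiagZ.
by apply/eq_mxdiag => i; exact: uU.
Qed.

Lemma mxfun_cqstate g A : (forall i, A i = adj (A i)) ->
  mxfun g (cqstate A) = cqstate (fun i => mxfun g (A i)).
Proof.
move=> hA.
have /choice[U /choice[x hU]] := fun i => herm_hdec (hA i).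
have uU i := (hU i).1.
have -> : A = fun i => hdec (U i) (x i) by apply/funext => i; have [] := hU i.
rewrite hdec_cqstate mxfun_hdec; last exact: unitary_cqstate.
rewrite -(hdec_cqstate _ (fun i => g \o x i)); apply: eq_mxdiag => i.
by rewrite mxfun_hdec.
Qed.

Lemma rtr_cqstate A : rtr (cqstate A) = \sum_i rtr (A i).
Proof. by rewrite /rtr mxtrace_mxdiag Re_sum. Qed.

Lemma trnorm_cqstate A : trnorm (cqstate A) = \sum_i trnorm (A i).
Proof.
rewrite /trnorm adj_cqstate cqstateM /mpow mxfun_cqstate.
  by rewrite -/(rtr _) rtr_cqstate.
by move=> i; rewrite adjmxM adjmxK.
Qed.

Lemma supp_le_cqstate A B : supp_le (cqstate A) (cqstate B) ->
  forall i, (A i <= B i)%MS.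
Proof.
move=> /submxP[Z] + i; rewrite -(submxblockK Z) {2}/cqstate mul_mxblock_mxdiag.
move=> /(congr1 (fun M => submxblock M i i)).
by rewrite submxblock_diag mxblockK => ->; exact: submxMl.
Qed.

Lemma cqstate_supp_le A B : (forall i, (A i <= B i)%MS) ->
  supp_le (cqstate A) (cqstate B).
Proof.
move=> AB; have /choice[Z ZE] : forall i, exists Z, A i = Z *m B i.
  by move=> i; apply/submxP.
have -> : A = fun i => Z i *m B i by apply/funext.
by rewrite -cqstateM /supp_le submxMl.
Qed.

End Blocks.

(** * Trace norm: dual form and conjugation *)

Section Powers.
Variable R : realType.
Local Notation C := R[i].
Variable d : nat.
Implicit Types A G S U V : 'M[C]_d.

Lemma gpowE (p x : R) : p != 0 -> gpow p x = powR x p.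
Proof. by move=> p0; rewrite /gpow; case: eqP => [->|//]; rewrite powR0. Qed.

Lemma trnorm_hdec U x : unitary U -> trnorm (hdec U x) = \sum_i `|x i|.
Proof.
move=> uU; rewrite /trnorm adj_hdec hdecM// /mpow mxfun_hdec// -/(rtr _) rtr_hdec//.
apply: eq_bigr => i _ /=; rewrite gpowE ?invr_eq0 ?pnatr_eq0//.
by rewrite -expr2 powR12_sqrt ?sqr_ge0// sqrtr_sqr.
Qed.

(** The sign matrix of [A], with eigenvalues among -1, 0 and 1, attains the dual form of the trace
    norm. *)
Lemma trnorm_sign A : A = adj A ->
  exists V y, [/\ unitary V, forall j, `|y j| <= 1 & trnorm A = rtr (A *m hdec V y)].
Proof.
move=> /herm_hdec[U [x [uU ->]]]; exists U, (Num.sg \o x); split=> // [j|].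
  by rewrite /= normr_sg; case: (_ != 0).
rewrite trnorm_hdec// hdecM// rtr_hdec//; apply: eq_bigr => i _ /=.
by rewrite normrEsg mulrC.
Qed.

(** Split the inner matrix into positive and negative parts. Conjugation by [S] keeps both positive,
    so pairing with a sign matrix costs at most their traces, which add up to the trace of the
    absolute value times [S *m S]. The overlap form prepares scalar Hoelder. *)
Lemma trnorm_conj_le S U V g s : unitary U -> unitary V ->
  S = hdec V s ->
  trnorm (S *m hdec U g *m S) <= \sum_i \sum_j overlap U V i j * (`|g i| * s j ^+ 2).
Proof.
move=> uU uV SE; have hS : S = adj S by rewrite SE adj_hdec.
set A := S *m _ *m S.
have hA : A = adj A by rewrite /A 2!adjmxM -hS adj_hdec mulmxA.
have [W [y [uW y1 ->]]] := trnorm_sign hA.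
pose gp i := Num.max (g i) 0; pose gn i := Num.max (- g i) 0.
have gE : hdec U g = hdec U gp - hdec U gn.
  rewrite hdecB; apply: eq_hdec => i; rewrite /gp /gn.
  by case: (ltP (g i) 0) => ?; case: (ltP (- g i) 0) => ?; lra.
have gA : hdec U (fun i => `|g i|) = hdec U gp + hdec U gn.
  rewrite hdecD; apply: eq_hdec => i; rewrite /gp /gn.
  case: (ltP (g i) 0) => h; case: (ltP (- g i) 0) => h';
    by [rewrite ltr0_norm//; lra|rewrite ger0_norm//; lra].
have pp : psdmx (S *m hdec U gp *m S).
  by apply: (psd_conj hS); apply: psd_hdec => i; rewrite le_max lexx orbT.
have pn : psdmx (S *m hdec U gn *m S).
  by apply: (psd_conj hS); apply: psd_hdec => i; rewrite le_max lexx orbT.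
have l1 : rtr (S *m hdec U gp *m S *m hdec W y) <= rtr (S *m hdec U gp *m S).
  have := rtr_psd_hdec_le pp uW (fun j => le_trans (ler_norm _) (y1 j)).
  by rewrite mul1r.
have y1' j : - y j <= 1 by apply: le_trans (ler_norm _) _; rewrite normrN.
have l2 : - rtr (S *m hdec U gn *m S *m hdec W y) <= rtr (S *m hdec U gn *m S).
  by have := rtr_psd_hdec_le pn uW y1'; rewrite hdecN mulmxN rtrN mul1r.
have -> : \sum_i \sum_j overlap U V i j * (`|g i| * s j ^+ 2) =
    rtr (S *m hdec U gp *m S) + rtr (S *m hdec U gn *m S).
  rewrite -rtrD -mulmxDl -mulmxDr -gA -mulmxA rtrC -mulmxA SE hdecM// rtr_hdecM.
  by apply: eq_bigr => i _; apply: eq_bigr => j _; rewrite mulrC expr2.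
rewrite /A gE mulmxBr !mulmxBl rtrB.
by apply: lerD; [exact: l1|exact: l2].
Qed.

End Powers.

(** * Deviation of a universal hash family *)

Section HuberTrace.
Variable R : realType.
Local Notation C := R[i].

(** For [r > 0] this is the maximiser of [2 * g * c - c ^+ 2] over [c] in [[- r, r]]; the maximum is
    the Huber function at the absolute value of [g]. *)
Definition clip (r g : R) : R := Num.max (- r) (Num.min r g).

Lemma clip_norm_le (r g : R) : 0 < r -> `|clip r g| <= r.
Proof.
move=> r0; rewrite /clip ler_norml.
by rewrite le_max lexx ge_max ge_min lexx/= !andbT; lra.
Qed.

Lemma huber_clip (r g : R) : 0 < r ->
  huber r `|g| = 2 * (g * clip r g) - clip r g * clip r g.
Proof.
move=> r0; rewrite /huber /clip ler_norml.
have [gr|gr] := leP g r; have [rg|rg] := leP (- r) g => /=.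
- by rewrite real_normK ?num_real//; ring.
- by rewrite (ltr0_norm (_ : g < 0)); [ring|lra].
- have rr : - r <= r by lra.
  by rewrite (max_idPr rr) gtr0_norm; [ring|lra].
- by exfalso; lra.
Qed.

(* [huber r] is the infimal convolution of [2 r |.|] and the square, here for matrices. *)
Lemma sum_huber_le d (G1 G2 V : 'M[C]_d) g r : unitary V -> 0 < r ->
  G1 + G2 = hdec V g -> G2 = adj G2 ->
  \sum_i huber r `|g i| <=
  2 * rtr (G1 *m hdec V (clip r \o g)) + rtr (G2 *m G2).
Proof.
move=> uV r0 GE hG2; set Y := hdec V (clip r \o g).
have -> : \sum_i huber r `|g i| = 2 * rtr ((G1 + G2) *m Y) - rtr (Y *m Y).
  rewrite GE !(hdecM _ _ uV) !(rtr_hdec _ uV) mulr_sumr -sumrB; apply: eq_bigr => i _.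
  exact: huber_clip.
have hY : Y = adj Y by rewrite adj_hdec.
(* The cross term of [G2] and [Y] is absorbed by the two squares. *)
have := rtr_herm_young hG2 hY; rewrite mulmxDl rtrD.
move: (rtr (G1 *m Y)) (rtr (G2 *m Y)) (rtr (G2 *m G2)) (rtr (Y *m Y)) => a b e h.
lra.
Qed.

End HuberTrace.

(** * Deviation from uniform: trace, square and Huber bounds *)

Section Hash.
Variable R : realType.
Local Notation C := R[i].
Local Notation rc := (real_complex R).
Variables (nX mM d : nat) (S : finType) (L : {set 'I_nX}) (f : S -> 'I_nX -> 'I_mM).
Hypothesis M0 : (0 < mM)%N.
Hypothesis S0 : (0 < #|S|)%N.
Implicit Types (X A : 'I_nX -> 'M[C]_d) (s : S) (m : 'I_mM).

Local Notation c := (mM%:R^-1 : R).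
Local Notation cS := (#|S|%:R^-1 : R).

(** For [X = W] this is, up to the factor [1 / #|L|], block [m] of the joint state minus the product
    state, for seed [s]. *)
Definition hashdev X s m : 'M[C]_d :=
  \sum_(l in L | f s l == m) X l - rc c *: \sum_(l in L) X l.

Lemma hashdevD X A s m :
  hashdev (fun l => X l + A l) s m = hashdev X s m + hashdev A s m.
Proof. by rewrite /hashdev !big_split/= scalerDr opprD addrACA. Qed.

Lemma adj_hashdev X s m : (forall l, X l = adj (X l)) ->
  hashdev X s m = adj (hashdev X s m).
Proof.
move=> hX; rewrite /hashdev adjmxB adjmxZ !adj_sum.
by congr (_ - _ *: _); apply: eq_bigr.
Qed.

Lemma hashdev_conj (T : 'M[C]_d) X s m :
  hashdev (fun l => T *m X l *m T) s m = T *m hashdev X s m *m T.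
Proof.
rewrite /hashdev mulmxBr mulmxBl -!mulmx_suml -!mulmx_sumr.
by rewrite -scalemxAr -scalemxAl.
Qed.

Lemma sum_hash (V : nmodType) (F : 'I_nX -> V) s :
  \sum_m \sum_(l in L | f s l == m) F l = \sum_(l in L) F l.
Proof. by rewrite [RHS](partition_big (f s) predT). Qed.

Lemma sum_inv_ord : \sum_(m < mM) c = 1.
Proof. by rewrite sumr_const card_ord -[c *+ _]mulr_natl mulfV// pnatr_eq0 -lt0n. Qed.

Lemma sum_inv_card : \sum_(s : S) cS = 1.
Proof. by rewrite sumr_const -[cS *+ _]mulr_natl mulfV// pnatr_eq0 -lt0n. Qed.

(** Dual form of the norm bound 2 on [l_1]: the preimage sums and the subtracted averages each
    contribute the total trace once, times the bound [r] on the test matrices. *)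
Lemma hashdev_pair_le A s (V : 'I_mM -> 'M[C]_d) y r :
  (forall l, psdmx (A l)) -> (forall m, unitary (V m)) ->
  (forall m j, `|y m j| <= r) ->
  \sum_m rtr (hashdev A s m *m hdec (V m) (y m)) <= 2 * r * \sum_(l in L) rtr (A l).
Proof.
move=> pA uV yr.
have -> : 2 * r * \sum_(l in L) rtr (A l) =
    \sum_m (r * \sum_(l in L | f s l == m) rtr (A l) + c * (r * \sum_(l in L) rtr (A l))).
  by rewrite big_split/= -mulr_sumr sum_hash -mulr_suml sum_inv_ord; ring.
apply: ler_sum => m _; rewrite /hashdev mulmxBl rtrB -scalemxAl rtrZ.
have l1 := @rtr_psd_hdec_le R d (\sum_(l in L | f s l == m) A l) (V m) r (y m)
  (psd_sum _ (fun l _ => pA l)) (uV m) (fun j => le_trans (ler_norm _) (yr m j)).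
have yr' j : - y m j <= r.
  by rewrite (le_trans (ler_norm _))// normrN.
have l2 := @rtr_psd_hdec_le R d (\sum_(l in L) A l) (V m) r _
  (psd_sum _ (fun l _ => pA l)) (uV m) yr'.
move: l1 l2; rewrite hdecN mulmxN rtrN !rtr_sum => l1 l2.
by apply: lerD => //; rewrite -mulrN ler_wpM2l// invr_ge0.
Qed.

Hypothesis uhf : forall l l', l \in L -> l' \in L -> l != l' ->
  #|[set s | f s l == f s l']|%:R / #|S|%:R <= c.

(** The preimage sums [a m] add up to [T], so the cross terms and the square of the average combine
    to [- 2 * c + c = - c]. *)
Lemma sum_hashdev_sqr A s :
  \sum_m rtr (hashdev A s m *m hashdev A s m) =
  \sum_(l in L) \sum_(l' in L) ((f s l == f s l')%:R - c) * rtr (A l *m A l').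
Proof.
pose T := \sum_(l in L) A l.
have TT : rtr (T *m T) = \sum_(l in L) \sum_(l' in L) rtr (A l *m A l').
  rewrite /T mulmx_suml rtr_sum; apply: eq_bigr => l _.
  by rewrite mulmx_sumr rtr_sum.
pose a m := \sum_(l in L | f s l == m) A l.
have aT : \sum_m rtr (a m *m T) = rtr (T *m T).
  by rewrite -rtr_sum -mulmx_suml /a sum_hash.
have aa : \sum_m rtr (a m *m a m) =
    \sum_(l in L) \sum_(l' in L) (f s l == f s l')%:R * rtr (A l *m A l').
  rewrite -[RHS](sum_hash _ s); apply: eq_bigr => m _.
  rewrite {1}/a mulmx_suml rtr_sum; apply: eq_bigr => l /andP[_ /eqP ->].
  rewrite /a mulmx_sumr rtr_sum big_mkcondr/=; apply: eq_bigr => l' _.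
  by rewrite eq_sym; case: eqP => _; rewrite ?mul1r ?mul0r.
have -> : \sum_m rtr (hashdev A s m *m hashdev A s m) =
    \sum_m (rtr (a m *m a m) - 2 * c * rtr (a m *m T) + c * (c * rtr (T *m T))).
  apply: eq_bigr => m _; rewrite /hashdev -/(a m) -/T.
  rewrite mulmxBl !mulmxBr -!scalemxAl -!scalemxAr !rtrB !rtrZ (rtrC T (a m)).
  by ring.
rewrite !big_split/= sumrN -mulr_sumr -mulr_suml sum_inv_ord aa aT TT.
rewrite mul1r -addrA -mulNr -mulrDl (_ : - (2 * c) + c = - c); last by ring.
rewrite mulr_sumr -big_split/=; apply: eq_bigr => l _.
rewrite mulr_sumr -big_split/=; apply: eq_bigr => l' _.
by rewrite mulrDl.
Qed.

Lemma hashdev_sqr_le A : (forall l, psdmx (A l)) ->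
  cS * \sum_s \sum_m rtr (hashdev A s m *m hashdev A s m) <=
  \sum_(l in L) rtr (A l *m A l).
Proof.
move=> pA; under eq_bigr do rewrite sum_hashdev_sqr.
rewrite exchange_big/= mulr_sumr; apply: ler_sum => l lL.
rewrite exchange_big/= mulr_sumr (bigD1 l)//=.
have c0 : 0 <= c by rewrite invr_ge0.
have K0 l' : 0 <= rtr (A l *m A l') by exact: rtr_psdM_ge0.
have E l' : cS * \sum_s ((f s l == f s l')%:R - c) * rtr (A l *m A l') =
    (#|[set s | f s l == f s l']|%:R / #|S|%:R - c) * rtr (A l *m A l').
  rewrite -mulr_suml mulrA; congr (_ * _).
  rewrite sumrB mulrBr sumr_const -(mulr_natl c) mulrA mulVf ?pnatr_eq0 -?lt0n//.
  rewrite mul1r mulrC; congr (_ / _ - _).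
  rewrite -natr_sum; congr (_%:R); rewrite -big_mkcond/= sum1_card.
  by apply: eq_card => s; rewrite inE.
rewrite -[leRHS]addr0; apply: lerD.
  rewrite E -[leRHS]mul1r ler_wpM2r// lerBlDr ler_wpDr//.
  by rewrite ler_pdivrMr ?ltr0n// mul1r ler_nat max_card.
apply: sumr_le0 => l' /andP[l'L ll']; rewrite E.
by rewrite mulr_le0_ge0// subr_le0 uhf// eq_sym.
Qed.

Lemma hashdev_huber X (U : 'I_nX -> 'M[C]_d) (x : 'I_nX -> 'I_d -> R)
    (V : S -> 'I_mM -> 'M[C]_d) (g : S -> 'I_mM -> 'I_d -> R) (r : R) :
  (forall l, unitary (U l)) -> (forall l i, 0 <= x l i) ->
  (forall l, X l = hdec (U l) (x l)) ->
  (forall s m, unitary (V s m)) ->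
  (forall s m, hashdev X s m = hdec (V s m) (g s m)) -> 0 < r ->
  cS * \sum_s \sum_m \sum_i huber r `|g s m i| <=
  \sum_(l in L) \sum_i huber (2 * r) (x l i).
Proof.
move=> uU x0 XE uV GE r0.
pose Y s m := hdec (V s m) (clip r \o g s m).
pose X1 l := hdec (U l) (fun i => Num.max (x l i - 2 * r) 0).
pose X2 l := hdec (U l) (fun i => Num.min (x l i) (2 * r)).
have p1 l : psdmx (X1 l) by apply: psd_hdec => i; rewrite le_max lexx orbT.
have p2 l : psdmx (X2 l).
  by apply: psd_hdec => i; rewrite le_min x0/= mulr_ge0// ltW.
have XD : X = fun l => X1 l + X2 l.
  apply/funext => l; rewrite XE hdecD; apply: eq_hdec => i.
  by case: (leP (x l i - 2 * r) 0) => ?; case: (leP (x l i) (2 * r)) => ?; lra.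
have le1 s m : \sum_i huber r `|g s m i| <=
    2 * rtr (hashdev X1 s m *m Y s m) + rtr (hashdev X2 s m *m hashdev X2 s m).
  apply: sum_huber_le; rewrite ?uV//.
    by rewrite -hashdevD -XD GE.
  by apply: adj_hashdev => l; exact: psd_adj.
apply: (@le_trans _ _ (cS * \sum_s \sum_m
    (2 * rtr (hashdev X1 s m *m Y s m) + rtr (hashdev X2 s m *m hashdev X2 s m)))).
  rewrite ler_wpM2l ?invr_ge0//; do 2!apply: ler_sum => ? _; exact: le1.
under eq_bigr do rewrite big_split/=.
rewrite big_split/= mulrDr.
(* The factor [4 * r] is 2 from the Huber estimate times [2 * r] from the pairing bound. The cut at
   [2 * r] fits it exactly: [4 * r * (x - 2 * r) + (2 * r) ^+ 2] is the Huber value at level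
   [2 * r]. *)
apply: (@le_trans _ _ (4 * r * (\sum_(l in L) rtr (X1 l)) +
    \sum_(l in L) rtr (X2 l *m X2 l))).
  apply: lerD; last exact: hashdev_sqr_le.
  have -> : 4 * r * (\sum_(l in L) rtr (X1 l)) =
      \sum_(s : S) cS * (4 * r * (\sum_(l in L) rtr (X1 l))).
    by rewrite -mulr_suml sum_inv_card mul1r.
  rewrite mulr_sumr.
  apply: ler_sum => s _; rewrite ler_wpM2l ?invr_ge0// -mulr_sumr.
  have := @hashdev_pair_le X1 s (V s) (fun m => clip r \o g s m) r p1 (uV s)
    (fun m j => clip_norm_le (g s m j) r0).
  rewrite -/(Y s _) => h; rewrite (_ : 4 * r = 2 * (2 * r)); last by ring.
  by rewrite -mulrA ler_wpM2l.
rewrite mulr_sumr -big_split/=; apply: ler_sum => l _.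
rewrite hdecM// !rtr_hdec// mulr_sumr -big_split/=; apply: ler_sum => i _.
rewrite /huber; case: (leP (x l i - 2 * r) 0) => h1; case: (leP (x l i) (2 * r)) => h2.
- by rewrite mulr0 add0r expr2.
- by exfalso; lra.
- by exfalso; lra.
- by rewrite le_eqVlt; apply/predU1P; left; ring.
Qed.

End Hash.

(** * From Huber functions to Schatten powers and trace norms *)

Section HashNorm.
Variable R : realType.
Local Notation C := R[i].
Variables (nX mM d : nat) (S : finType) (L : {set 'I_nX}) (f : S -> 'I_nX -> 'I_mM).
Hypothesis M0 : (0 < mM)%N.
Hypothesis S0 : (0 < #|S|)%N.
Hypothesis uhf : forall l l', l \in L -> l' \in L -> l != l' ->
  #|[set s | f s l == f s l']|%:R / #|S|%:R <= (mM%:R^-1 : R).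
Variables (X U : 'I_nX -> 'M[C]_d) (x : 'I_nX -> 'I_d -> R).
Hypothesis uU : forall l, unitary (U l).
Hypothesis x0 : forall l i, 0 <= x l i.
Hypothesis XE : forall l, X l = hdec (U l) (x l).
Local Notation cS := (#|S|%:R^-1 : R).

(** Homogeneity of degree 2 brings both sides of [hashdev_huber] to the same level [r], as
    [huber_sum_powR] demands. *)
Lemma huber_half (r y : R) : huber (2 * r) y = 4 * huber r (y / 2).
Proof.
rewrite /huber ler_pdivrMr// [r * 2]mulrC.
by case: ifP => _; field.
Qed.

Lemma hashdev_powR (V : S -> 'I_mM -> 'M[C]_d) (g : S -> 'I_mM -> 'I_d -> R) (p : R) :
  (forall s m, unitary (V s m)) ->
  (forall s m, hashdev L f X s m = hdec (V s m) (g s m)) -> 1 < p <= 2 ->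
  cS * \sum_s \sum_m \sum_i `|g s m i| `^ p <=
  2 `^ (2 - p) * \sum_(l in L) \sum_i x l i `^ p.
Proof.
move=> uV GE p12.
(* Both sides become one signed sum: deviation eigenvalues with weight [- cS], halved eigenvalues of
   [X l] with weight 4. Powers then produce 4 divided by the [p]-th power of 2, the constant
   claimed. *)
pose T := (S * 'I_mM * 'I_d + 'I_nX * 'I_d)%type.
pose y (t : T) : R := match t with
  | inl u => `|g u.1.1 u.1.2 u.2| | inr u => x u.1 u.2 / 2 end.
pose v (t : T) : R := match t with
  | inl u => - cS | inr u => 4 * (u.1 \in L)%:R end.
have E (F : R -> R) : \sum_t v t * F (y t) =
    4 * (\sum_(l in L) \sum_i F (x l i / 2)) - cS * \sum_s \sum_m \sum_i F `|g s m i|.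
  rewrite big_sumType/= addrC; congr (_ + _).
    rewrite -(pair_bigA _ (fun l i => 4 * (l \in L)%:R * F (x l i / 2)))/=.
    rewrite mulr_sumr [RHS]big_mkcond/=; apply: eq_bigr => l _.
    rewrite -mulr_sumr; case: (l \in L); first by rewrite mulr1.
    by rewrite mulr0 mul0r.
  rewrite -mulr_sumr mulNr; congr (- (_ * _)).
  rewrite -(pair_bigA _ (fun sm i => F `|g sm.1 sm.2 i|))/=.
  by rewrite -(pair_bigA _ (fun s m => \sum_i F `|g s m i|)).
have y0 t : 0 <= y t by case: t => u /=; rewrite ?divr_ge0.
have H r : 0 < r -> 0 <= \sum_t v t * huber r (y t).
  move=> r0; rewrite E subr_ge0.
  have := hashdev_huber M0 S0 uhf uU x0 XE uV GE r0.
  move/le_trans; apply; rewrite mulr_sumr; apply: ler_sum => l _.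
  by rewrite mulr_sumr; apply: ler_sum => i _; rewrite huber_half.
have := huber_sum_powR p12 y0 H; rewrite (E (fun u => u `^ p)) subr_ge0.
move/le_trans; apply; rewrite !mulr_sumr; apply: ler_sum => l _.
rewrite !mulr_sumr; apply: ler_sum => i _.
rewrite powRM ?invr_ge0// mulrCA mulrC ler_wpM2r ?powR_ge0//.
rewrite powRB ?pnatr_eq0 ?implybT// -powR_inv1// powRAC powR_inv1 ?powR_ge0//.
by rewrite (powR_mulrn 2)// -natrX.
Qed.

(** One application of Hoelder over seeds, messages and pairs of eigenvectors, weighted by overlaps.
    Here [V] and [w] diagonalise a power of the reference state. *)
Lemma hashdev_trnorm_le (V : 'M[C]_d) (w : 'I_d -> R) (p q : R) :
  unitary V -> 1 < p <= 2 -> 0 < q -> p^-1 + q^-1 = 1 ->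
  (forall j, 0 <= w j) -> \sum_j (w j ^+ 2) `^ q = 1 ->
  cS * \sum_s \sum_m trnorm (hdec V w *m hashdev L f X s m *m hdec V w) <=
  (2 `^ (2 - p) * \sum_(l in L) \sum_i x l i `^ p) `^ p^-1 * mM%:R `^ q^-1.
Proof.
move=> uV p12 q0 pq w0 w1; have /andP[p1 p2] := p12.
have p0 : 0 < p by apply: lt_trans p1.
have hX l : X l = adj (X l) by rewrite XE adj_hdec.
have /choice[Z /choice[g hZ]] : forall sm : S * 'I_mM, exists Z g,
    unitary Z /\ hashdev L f X sm.1 sm.2 = hdec Z g.
  by move=> sm; apply: herm_hdec; exact: adj_hashdev.
have uZ sm := (hZ sm).1; have GE sm := (hZ sm).2.
pose W (t : S * 'I_mM * ('I_d * 'I_d)) := cS * overlap (Z t.1) V t.2.1 t.2.2.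
have cS0 : 0 <= cS by rewrite invr_ge0.
have W0 t : 0 <= W t by rewrite mulr_ge0 ?overlap_ge0.
apply: (@le_trans _ _ (\sum_t W t * (`|g t.1 t.2.1| * w t.2.2 ^+ 2))).
  rewrite -(pair_bigA _ (fun sm ij => W (sm, ij) * (`|g sm ij.1| * w ij.2 ^+ 2)))/=.
  rewrite pair_bigA mulr_sumr; apply: ler_sum => sm _.
  rewrite -(pair_bigA _ (fun i j => W (sm, (i, j)) * (`|g sm i| * w j ^+ 2)))/=.
  have := @trnorm_conj_le R d (hdec V w) (Z sm) V (g sm) w (uZ sm) uV erefl.
  rewrite -GE => h; apply: le_trans (ler_wpM2l cS0 h) _.
  rewrite mulr_sumr; apply: ler_sum => i _; rewrite mulr_sumr; apply: ler_sum => j _.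
  by rewrite mulrA.
apply: le_trans (hoelder_sum p0 q0 pq W0 _ _) _ => [t|t|]; rewrite ?sqr_ge0//.
(* Summing overlaps over [i] gives one and [w1] removes [j]; averaging over seeds leaves one unit
   per message. *)
have -> : \sum_t W t * (w t.2.2 ^+ 2) `^ q = mM%:R.
  rewrite -(pair_bigA _ (fun sm ij => W (sm, ij) * (w ij.2 ^+ 2) `^ q))/=.
  have E sm : \sum_ij W (sm, ij) * (w ij.2 ^+ 2) `^ q = cS.
    rewrite -(pair_bigA _ (fun i j => W (sm, (i, j)) * (w j ^+ 2) `^ q))/=.
    rewrite exchange_big/= -[RHS]mulr1 -[X in _ = _ * X]w1 mulr_sumr; apply: eq_bigr => j _.
    rewrite -mulr_suml -mulr_sumr; congr (_ * _).
    by rewrite (overlap_suml j (uZ sm) uV) mulr1.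
  under eq_bigr do rewrite E.
  rewrite -(pair_bigA _ (fun s m => cS))/=.
  under eq_bigr do rewrite sumr_const card_ord -[cS *+ _]mulr_natl.
  by rewrite -mulr_sumr sum_inv_card// mulr1.
rewrite ler_wpM2r ?powR_ge0//.
have -> : \sum_t W t * `|g t.1 t.2.1| `^ p =
    cS * \sum_s \sum_m \sum_i `|g (s, m) i| `^ p.
  rewrite -(pair_bigA _ (fun sm ij => W (sm, ij) * `|g sm ij.1| `^ p))/=.
  rewrite (pair_bigA _ (fun s m => \sum_i `|g (s, m) i| `^ p))/= mulr_sumr.
  apply: eq_bigr => -[s m] _ /=.
  rewrite -(pair_bigA _ (fun i j => W ((s, m), (i, j)) * `|g (s, m) i| `^ p))/=.
  rewrite mulr_sumr; apply: eq_bigr => i _.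
  rewrite -mulr_suml -mulr_sumr; congr (_ * _).
  by rewrite (overlap_sumr i (uZ (s, m)) uV) mulr1.
apply: ge0_ler_powR; rewrite ?invr_ge0 ?(ltW p0)// ?nnegrE.
- rewrite mulr_ge0//; do 3!apply: sumr_ge0 => ? _; exact: powR_ge0.
- rewrite mulr_ge0 ?powR_ge0//; do 2!apply: sumr_ge0 => ? _; exact: powR_ge0.
exact: (@hashdev_powR (fun s m => Z (s, m)) (fun s m => g (s, m)) p
  (fun s m => uZ (s, m)) (fun s m => GE (s, m)) p12).
Qed.

End HashNorm.

(** * Distance to uniform and sandwiched divergence *)

Section Channel.
Variable R : realType.
Local Notation C := R[i].
Local Notation rc := (real_complex R).
Variables (nX mM d : nat) (S : finType) (W : 'I_nX -> 'M[C]_d).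
Variables (L : {set 'I_nX}) (f : S -> 'I_nX -> 'I_mM).
Hypothesis dW : forall l, density (W l).
Hypothesis L0 : (0 < #|L|)%N.
Hypothesis M0 : (0 < mM)%N.
Hypothesis S0 : (0 < #|S|)%N.
Hypothesis uhf : forall l l', l \in L -> l' \in L -> l != l' ->
  #|[set s | f s l == f s l']|%:R / #|S|%:R <= (mM%:R^-1 : R).
Local Notation N := (#|L|%:R : R).
Local Notation cS := (#|S|%:R^-1 : R).

Let N0 : 0 < N. Proof. by rewrite ltr0n. Qed.
Let pW l : psdmx (W l). Proof. by have [] := dW l. Qed.

Lemma real_complex_natV k : rc (k%:R^-1) = (k%:R)^-1.
Proof. by rewrite fmorphV rmorph_nat. Qed.

Lemma trnormZ (c : R) (A : 'M[C]_d) : 0 <= c -> A = adj A ->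
  trnorm (rc c *: A) = c * trnorm A.
Proof.
move=> c0 /herm_hdec[U [x [uU ->]]]; rewrite hdecZ !trnorm_hdec// mulr_sumr.
by apply: eq_bigr => i _; rewrite normrM ger0_norm.
Qed.

Lemma dbarE : dbar W L f =
  N^-1 * (cS * \sum_s \sum_m trnorm (hashdev L f W s m)).
Proof.
rewrite /dbar mulrCA; congr (_ * _); rewrite mulr_sumr; apply: eq_bigr => s _.
rewrite cqstateB trnorm_cqstate mulr_sumr; apply: eq_bigr => m _.
have hG : hashdev L f W s m = adj (hashdev L f W s m).
  by apply: adj_hashdev => l; exact: psd_adj.
have N'0 : 0 <= N^-1 by rewrite invr_ge0.
rewrite -(trnormZ N'0 hG); congr trnorm; rewrite /tau_E /tau_blocks -scaler_sumr sum_hash /hashdev.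
(* The two normalisations of the blocks collapse to [1 / #|L|]. *)
have -> : (mM%:R^-1 * (#|L|%:R / mM%:R)^-1 : C) = rc N^-1.
  by rewrite real_complex_natV invf_div mulrA mulVf ?mul1r// pnatr_eq0 -lt0n.
by rewrite scalerBr -real_complex_natV !scalerA mulrC.
Qed.

(** The endpoint [t = 0]: pairing with sign matrices reduces it to the [l_1] estimate with
    [r = 1]. *)
Lemma dbar_le2 : dbar W L f <= 2.
Proof.
rewrite dbarE mulrC ler_pdivrMr//.
have -> : 2 * N = \sum_(s : S) cS * (2 * 1 * \sum_(l in L) rtr (W l)).
  rewrite -mulr_suml sum_inv_card// mul1r mulr1; congr (_ * _).
  by under eq_bigr => l _ do rewrite /rtr (dW l).2; rewrite /= sumr_const.
rewrite mulr_sumr; apply: ler_sum => s _; rewrite ler_wpM2l ?invr_ge0//.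
have hG m : hashdev L f W s m = adj (hashdev L f W s m).
  by apply: adj_hashdev => l; exact: psd_adj.
have /choice[V /choice[y hV]] := fun m => trnorm_sign (hG m).
under eq_bigr => m _ do (have [_ _ ->] := hV m).
by apply: hashdev_pair_le => // m; have [] := hV m.
Qed.

Variable t : R.
Hypothesis t01 : 0 < t <= 1.
Local Notation a := (t / (2 * (1 + t))).
Let t0 : 0 < t. Proof. by case/andP: t01. Qed.
Let t1 : 0 < 1 + t. Proof. by rewrite addr_gt0. Qed.
Let a0 : 0 < a. Proof. by rewrite divr_gt0// mulr_gt0. Qed.

Variables (V : 'M[C]_d) (y : 'I_d -> R).
Hypothesis uV : unitary V.
Hypothesis y0 : forall j, 0 <= y j.
Hypothesis y1 : \sum_j y j = 1.
Local Notation sigma := (hdec V y).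
Hypothesis supp : forall l, l \in L -> (W l <= sigma)%MS.

Let X l := mpow sigma (- a) *m W l *m mpow sigma (- a).

Lemma mpow_hdec p : mpow sigma p = hdec V (gpow p \o y).
Proof. by rewrite /mpow mxfun_hdec. Qed.

(** Opposite powers of [sigma] multiply to its support projector [P]. Support inclusion gives
    [W l *m P = W l], and taking adjoints gives the other side. *)
Lemma channel_sandwichK l : l \in L -> W l = mpow sigma a *m X l *m mpow sigma a.
Proof.
move=> lL; pose P := hdec V (fun j => (y j != 0)%:R).
have PE : mpow sigma a *m mpow sigma (- a) = P.
  rewrite !mpow_hdec (hdecM _ _ uV); apply: eq_hdec => j /=; rewrite /gpow.
  case: eqP => [_|/eqP yj]; first by rewrite mul0r.
  by rewrite powRN mulfV// powR_eq0 negb_and yj.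
have PE' : mpow sigma (- a) *m mpow sigma a = P.
  by rewrite -PE !mpow_hdec !(hdecM _ _ uV); apply: eq_hdec => j /=; rewrite mulrC.
have sP : sigma *m P = sigma.
  rewrite (hdecM _ _ uV); apply: eq_hdec => j.
  by case: eqP => [->|_]; rewrite ?mul0r// mulr1.
have WP : W l *m P = W l.
  by have /submxP[Z ->] := supp lL; rewrite -mulmxA sP.
have PW : P *m W l = W l.
  have := congr1 (@adj R d d) WP.
  by rewrite adjmxM adj_hdec -(psd_adj (pW l)).
rewrite /X; move: (mpow sigma a) (mpow sigma (- a)) PE PE' => A B PE PE'.
clearbody P; by rewrite !mulmxA PE -!mulmxA PE' WP PW.
Qed.

Variables (U : 'I_nX -> 'M[C]_d) (x : 'I_nX -> 'I_d -> R).
Hypothesis uU : forall l, unitary (U l).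
Hypothesis x0 : forall l i, 0 <= x l i.
Hypothesis XE : forall l, X l = hdec (U l) (x l).

Lemma sandwiched_trace :
  let s := mpow (cqstate (fun l => \tr (WxPL W L l) *: sigma)) (- a) in
  rtr (mpow (s *m cqstate (WxPL W L) *m s) (1 + t)) =
  N^-1 * \sum_(l in L) \sum_i x l i `^ (1 + t).
Proof.
have Bt l : \tr (WxPL W L l) = rc (if l \in L then N^-1 else 0).
  rewrite /WxPL; case: ifP => _; last by rewrite mxtrace0.
  by rewrite mxtraceZ (dW l).2 mulr1 real_complex_natV.
have Bh l : WxPL W L l = rc (if l \in L then N^-1 else 0) *: W l.
  by rewrite /WxPL; case: ifP => _; rewrite ?real_complex_natV ?rmorph0 ?scale0r.
have e1 : 1 + t != 0 by rewrite gt_eqF.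
have a1 : - a != 0 by rewrite oppr_eq0 gt_eqF.
rewrite /= {2 3}/mpow mxfun_cqstate => [|l]; last by rewrite Bt adjmxZ adj_hdec.
rewrite !cqstateM /mpow.
pose k := N^-1 `^ (- a) * N^-1 * N^-1 `^ (- a).
have Ni : 0 < N^-1 by rewrite invr_gt0.
have k0 : 0 <= k by rewrite !mulr_ge0 ?powR_ge0// ltW.
have bE l : mxfun (gpow (- a)) (\tr (WxPL W L l) *: sigma) *m WxPL W L l *m
    mxfun (gpow (- a)) (\tr (WxPL W L l) *: sigma) =
    hdec (U l) (fun i => if l \in L then k * x l i else 0).
  rewrite Bt Bh; case: ifP => lL; last first.
    rewrite rmorph0 !scale0r mulmx0 mul0mx -[LHS](scale0r (hdec (U l) (x l))).
    by rewrite -(rmorph0 rc) hdecZ; apply: eq_hdec => i; rewrite mul0r.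
  have -> : mxfun (gpow (- a)) (rc N^-1 *: sigma) = rc (N^-1 `^ (- a)) *: mpow sigma (- a).
    rewrite mpow_hdec !hdecZ mxfun_hdec//; apply: eq_hdec => j /=.
    by rewrite !gpowE// powRM// ltW.
  rewrite -!scalemxAl -!scalemxAr -!scalemxAl !scalerA -/(X l) XE -!rmorphM hdecZ.
  by apply: eq_hdec => i; rewrite /k; congr (_ * _); ring.
(* Both copies of [N^-1] in the reference state and the one in the block combine to exponent
   [1 - 2 * a], which is [(1 + t)^-1]. *)
have kp : k `^ (1 + t) = N^-1.
  have -> : k = N^-1 `^ (1 - 2 * a).
    rewrite /k -{2}(powRr1 (ltW Ni)) -!powRD ?(gt_eqF Ni) ?implybT//.
    by congr (_ `^ _); ring.
  rewrite -powRrM (_ : _ * _ = 1) ?powRr1 ?ltW//.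
  by field; rewrite gt_eqF.
rewrite mxfun_cqstate => [|l]; last by rewrite bE adj_hdec.
rewrite rtr_cqstate mulr_sumr [RHS]big_mkcond/=; apply: eq_bigr => l _.
rewrite bE mxfun_hdec// rtr_hdec//; case: ifP => lL /=.
  rewrite mulr_sumr; apply: eq_bigr => i _.
  by rewrite gpowE// powRM// kp.
by rewrite big1// => i _; rewrite /gpow eqxx.
Qed.

Lemma dbar_le_sandwiched Q :
  Q = N^-1 * \sum_(l in L) \sum_i x l i `^ (1 + t) ->
  dbar W L f <= 2 `^ ((1 - t) / (1 + t)) *
    (N / mM%:R) `^ (- (t / (1 + t))) * Q `^ ((1 + t)^-1).
Proof.
move=> QE; have /andP[_ tle1] := t01.
have QN : \sum_(l in L) \sum_i x l i `^ (1 + t) = N * Q.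
  by rewrite QE mulrA mulfV ?mul1r// gt_eqF.
have Q0 : 0 <= Q.
  rewrite QE mulr_ge0 ?invr_ge0//.
  by do 2!apply: sumr_ge0 => ? _; exact: powR_ge0.
have a1 : a != 0 by rewrite gt_eqF.
pose w j := y j `^ a.
have SE : mpow sigma a = hdec V w.
  by rewrite mpow_hdec; apply: eq_hdec => j /=; rewrite gpowE.
(* The conjugate exponent of [1 + t]; since [2 * a * q = 1], the powers in [wq] return the
   eigenvalues of [sigma], which sum to one. *)
pose q := (1 + t) / t.
have q0 : 0 < q by rewrite divr_gt0.
have pq : (1 + t)^-1 + q^-1 = 1 by rewrite /q; field; rewrite !gt_eqF.
have wq j : (w j ^+ 2) `^ q = y j.
  rewrite -powR_mulrn ?powR_ge0// -!powRrM (_ : _ * _ = 1) ?powRr1//.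
  by rewrite /q; field; rewrite !gt_eqF.
have w1 : \sum_j (w j ^+ 2) `^ q = 1 by under eq_bigr do rewrite wq.
have p12 : 1 < 1 + t <= 2 by rewrite ltrDl t0 -[2]/(1 + 1) lerD2l.
have := hashdev_trnorm_le M0 S0 uhf uU x0 XE uV p12 q0 pq (fun j => powR_ge0 _ _) w1.
rewrite -/w QN => h.
have -> : dbar W L f = N^-1 *
    (cS * \sum_s \sum_m trnorm (hdec V w *m hashdev L f X s m *m hdec V w)).
  rewrite dbarE; congr (_ * (_ * _)); apply: eq_bigr => s _; apply: eq_bigr => m _.
  congr trnorm; rewrite -hashdev_conj -SE /hashdev.
  congr (_ - _ *: _); apply: eq_bigr => l; last exact: channel_sandwichK.
  by case/andP => lL _; exact: channel_sandwichK.
have iN0 : 0 <= N^-1 by rewrite invr_ge0.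
apply: le_trans (ler_wpM2l iN0 h) _; rewrite le_eqVlt; apply/predU1P; left.
have Mp : 0 < (mM%:R : R) by rewrite ltr0n.
rewrite !powRM ?powR_ge0 ?mulr_ge0 ?invr_ge0 ?(ltW Mp) ?(ltW N0)//.
rewrite -powRrM (_ : (2 - (1 + t)) / (1 + t) = (1 - t) / (1 + t)); last first.
  by congr (_ / _); ring.
have -> : q^-1 = t / (1 + t) by rewrite /q invf_div.
have -> : N `^ (1 + t)^-1 = N * N `^ (- (t / (1 + t))).
  rewrite -{2}(powRr1 (ltW N0)) -powRD ?(gt_eqF N0) ?implybT//.
  by congr (_ `^ _); field; rewrite gt_eqF.
have -> : (mM%:R^-1 : R) `^ (- (t / (1 + t))) = mM%:R `^ (t / (1 + t)).
  by rewrite -powR_inv1 ?(ltW Mp)// -powRrM mulN1r opprK.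
by field; rewrite gt_eqF.
Qed.

End Channel.

(** * Support conditions and the divergence as a trace functional *)

Section Divergence.
Variable R : realType.
Local Notation C := R[i].
Local Notation rc := (real_complex R).
Variables (nX mM d : nat) (S : finType) (W : 'I_nX -> 'M[C]_d).
Variables (L : {set 'I_nX}) (f : S -> 'I_nX -> 'I_mM).
Hypothesis dW : forall l, density (W l).
Hypothesis L0 : (0 < #|L|)%N.
Local Notation N := (#|L|%:R : R).

(* In [universal_hash] the set of colliding seeds is a classical set. *)
Lemma universal_hash_collision : universal_hash R L f ->
  forall l l', l \in L -> l' \in L -> l != l' ->
  #|[set s | f s l == f s l']|%:R / #|S|%:R <= (mM%:R^-1 : R).
Proof.
move=> [uhf _] l l' lL l'L ll'; apply: le_trans (uhf l l' lL l'L ll').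
rewrite le_eqVlt; apply/predU1P; left; congr (_%:R / _).
apply: eq_card => s; rewrite !inE.
by apply/idP/idP => [|/set_mem//] h; apply/mem_set.
Qed.

Lemma powR2_log2 (c z : R) : 0 < z -> 2 `^ (c * log2 z) = z `^ c.
Proof.
move=> z0; rewrite /log2 /powR pnatr_eq0/= (gt_eqF z0) -!mulrA mulVf ?mulr1//.
by rewrite gt_eqF// ln_gt0// ltr1n.
Qed.

(** Hides the diagonalisations: the same number [Q] gives the divergence and the bound on [dbar]. *)
Lemma sandwiched_dbar (t : R) (sigma : 'M[C]_d) :
  (0 < mM)%N -> (0 < #|S|)%N -> universal_hash R L f ->
  0 < t <= 1 -> density sigma ->
  supp_le (cqstate (WxPL W L)) (cqstate (fun l => \tr (WxPL W L l) *: sigma)) ->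
  exists Q : R,
    sandwiched t (cqstate (WxPL W L)) (cqstate (fun l => \tr (WxPL W L l) *: sigma))
      = (t^-1 * log2 Q)%:E /\
    [/\ 0 <= Q & dbar W L f <= 2 `^ ((1 - t) / (1 + t)) *
      (N / mM%:R) `^ (- (t / (1 + t))) * Q `^ ((1 + t)^-1)].
Proof.
move=> M0 S0 /universal_hash_collision uhf t01 [ps tr1] supp.
have [V [y [uV sE y0]]] := psd_hdecP ps.
have y1 : \sum_j y j = 1 by rewrite -(rtr_hdec y uV) -sE /rtr tr1.
have Ws l : l \in L -> (W l <= hdec V y)%MS.
  move=> lL; have := supp_le_cqstate supp l; rewrite sE.
  have N0 : (#|L|%:R^-1 : C) != 0 by rewrite invr_eq0 pnatr_eq0 -lt0n.
  by rewrite /WxPL lL mxtraceZ (dW l).2 mulr1 !eqmx_scale.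
pose a := t / (2 * (1 + t)).
have pX : forall l, psdmx (mpow (hdec V y) (- a) *m W l *m mpow (hdec V y) (- a)).
  by move=> l; apply: psd_conj; [rewrite mpow_hdec// adj_hdec|have [] := dW l].
have /choice[U /choice[x hU]] := fun l => psd_hdecP (pX l).
have uU l : unitary (U l) by have [] := hU l.
have XE l : mpow (hdec V y) (- a) *m W l *m mpow (hdec V y) (- a) = hdec (U l) (x l).
  by have [] := hU l.
have x0 l i : 0 <= x l i by have [] := hU l.
exists (N^-1 * \sum_(l in L) \sum_i x l i `^ (1 + t)); split; last split.
- have t0 : t != 0 by rewrite gt_eqF//; case/andP: t01.
  rewrite /sandwiched (negbTE t0) supp sE -/(rtr _).
  by rewrite (sandwiched_trace dW L0 t01 uV y0 uU x0 XE).
- rewrite mulr_ge0 ?invr_ge0//.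
  by do 2!apply: sumr_ge0 => ? _; exact: powR_ge0.
- exact: (dbar_le_sandwiched dW L0 M0 S0 uhf t01 uV y0 y1 Ws uU x0 XE).
Qed.

Lemma density_dim_gt0 : (0 < d)%N.
Proof.
have /card_gt0P[l _] := L0; have [_] := dW l.
rewrite lt0n; apply: contra_eq_neq => d0.
by move: (W l); rewrite d0 => A; rewrite /mxtrace big_ord0 eq_sym oner_eq0.
Qed.

(** The maximally mixed state; it keeps the infimum [Idown] below [+oo]. *)
Lemma full_supp_density : exists2 sigma : 'M[C]_d, density sigma &
  supp_le (cqstate (WxPL W L)) (cqstate (fun l => \tr (WxPL W L l) *: sigma)).
Proof.
have d0 : d%:R != 0 :> R by rewrite pnatr_eq0 -lt0n density_dim_gt0.
exists (rc d%:R^-1 *: 1%:M); first split.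
- apply: psdZ; first by rewrite invr_ge0.
  rewrite -(@hdec1 R d 1%:M); last by rewrite /unitary adjmx1 mulmx1.
  by apply: psd_hdec => i.
- by rewrite mxtraceZ mxtrace1 -(rmorph_nat rc) -rmorphM/= mulVf.
apply: cqstate_supp_le => l; rewrite /WxPL; case: ifP => _; last exact: sub0mx.
have N0 : (#|L|%:R^-1 : C) != 0 by rewrite invr_eq0 pnatr_eq0 -lt0n.
have d0' : rc d%:R^-1 != 0 by rewrite fmorph_eq0 invr_eq0.
by rewrite mxtraceZ (dW l).2 mulr1 !eqmx_scale// submx1.
Qed.

End Divergence.

Theorem theorem1 (R : realType) (nX mM d : nat) (S : finType)
  (W : 'I_nX -> 'M[R[i]]_d) (L : {set 'I_nX}) (f : S -> 'I_nX -> 'I_mM) :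
  (forall x, density (W x)) ->
  (0 < #|L|)%N ->
  (0 < #|S|)%N ->
  universal_hash R L f ->
  forall t : R, 0 <= t <= 1 ->
    dbar W L f <=
      powR 2 ((1 - t) / (1 + t)) *
      powR 2 (t / (1 + t) *
              (- log2 (#|L|%:R / mM%:R) + fine (Idown t (WxPL W L)))).
Proof.
move=> dW L0 S0 uhf t /andP[t0 t1].
have M0 : (0 < mM)%N.
  have /card_gt0P[l _] := L0; have /card_gt0P[s _] := S0.
  exact: leq_trans (ltn_ord (f s l)).
have [->|tn0] := eqVneq t 0.
  rewrite subr0 addr0 divr1 powRr1// mul0r mul0r powRr0 mulr1.
  by apply: dbar_le2 => //; exact: universal_hash_collision.
have tp : 0 < t by rewrite lt_def tn0.
have tp1 : 0 < 1 + t by rewrite addr_gt0.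
have t01 : 0 < t <= 1 by rewrite tp.
pose k : R := #|L|%:R / mM%:R; pose b := t / (1 + t).
have k0 : 0 < k by rewrite divr_gt0 ?ltr0n.
have b0 : 0 < b by rewrite divr_gt0.
pose K u := 2 `^ ((1 - t) / (1 + t)) * 2 `^ (b * (- log2 k + u)).
rewrite -/b -/k -/(K _).
(* For a positive distance, logarithms turn the claim into a lower bound [l] on the divergence, a
   form that passes to the infimum. *)
have [D0|D0] := leP (dbar W L f) 0; first by rewrite (le_trans D0)// mulr_ge0 ?powR_ge0.
have ln2 : 0 < ln 2 :> R by rewrite ln_gt0// ltr1n.
have KE u : (dbar W L f <= K u) =
    ((ln (dbar W L f) - (1 - t) / (1 + t) * ln 2) / (b * ln 2) + log2 k <= u).
  have Kp : 0 < K u by rewrite mulr_gt0 ?powR_gt0.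
  rewrite -(ler_ln D0 Kp) /K lnM ?posrE ?powR_gt0// !ln_powR.
  rewrite -[RHS]lerBrDr [RHS](ler_pdivrMr _ _ (mulr_gt0 b0 ln2)).
  rewrite [RHS]lerBlDl; congr (_ <= _ + _).
  by ring.
rewrite KE; set l := (X in X <= _).
have lb sigma : density sigma ->
    (l%:E <= sandwiched t (cqstate (WxPL W L))
               (cqstate (fun x => \tr (WxPL W L x) *: sigma)))%E.
  move=> dsigma; have [supp|nsupp] := boolP (supp_le (cqstate (WxPL W L))
    (cqstate (fun x => \tr (WxPL W L x) *: sigma))); last first.
    by rewrite /sandwiched (negbTE tn0) (negbTE nsupp) leey.
  have [Q [-> [Q0 DQ]]] := sandwiched_dbar dW L0 M0 S0 uhf t01 dsigma supp.
  (* [Q = 0] would make the bound vanish, against [D0]; positivity allows [log2 Q] to be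
     exponentiated back. *)
  have Qp : 0 < Q.
    rewrite lt_def Q0 andbT; apply: contraTneq DQ => ->.
    by rewrite powR0 ?invr_eq0 ?gt_eqF// mulr0 -ltNge.
  rewrite lee_fin -KE (le_trans DQ)// /K -mulrA ler_wpM2l ?powR_ge0//.
  rewrite mulrDr powRD ?pnatr_eq0 ?implybT// mulrN -mulNr powR2_log2//.
  rewrite ler_wpM2l ?powR_ge0// mulrA powR2_log2//.
  rewrite (_ : b / t = (1 + t)^-1)//.
  by rewrite /b; field; rewrite !gt_eqF.
(* The infimum lies between [l] and a real value, so it is finite and [fine] returns it rather than
   a default. *)
have [sigma dsigma supp] := full_supp_density dW L0.
have [Q [QE _]] := sandwiched_dbar dW L0 M0 S0 uhf t01 dsigma supp.
have ub : (Idown t (WxPL W L) <= (t^-1 * log2 Q)%:E)%E.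
  by rewrite -QE; apply: ereal_inf_lbound; exists sigma.
have : (l%:E <= Idown t (WxPL W L))%E.
  by apply/ereal_infP => _ [s ds <-]; exact: lb.
by case: (Idown t (WxPL W L)) ub => [r|//|//] _; rewrite lee_fin.
Qed.
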